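(* Let $\mathcal{I}=(I_n)_{n\ge 1}$ be a nonzero $\mathrm{Inc}$-invariant chain of proper monomial ideals $I_n\subsetneq R_n=K[x_1,\dots,x_n]$. Then $$\lim_{n\to\infty}\frac{\operatorname{reg} I_n}{n}=w(\mathcal{I})-1.$$
   Context: $\mathbb{N}$ is the set of positive integers, $K$ is a field, $R=K[x_i\mid i\in\mathbb{N}]$, and $R_n=K[x_1,\dots,x_n]\subset R$. $\mathrm{Inc}$ is the monoid of strictly increasing maps $\pi:\mathbb{N}\to\mathbb{N}$, acting on $R$ by $K$-algebra endomorphisms with $\pi\cdot x_i=x_{\pi(i)}$; for $m\le n$ put $\mathrm{Inc}_{m,n}=\{\pi\in\mathrm{Inc}\mid \pi(m)\le n\}$. A chain of ideals $\mathcal{I}=(I_n)_{n\ge1}$, with $I_n$ an ideal of $R_n$, is $\mathrm{Inc}$-invariant if $\langle \mathrm{Inc}_{m,n}(I_m)\rangle_{R_n}\subseteq I_n$ for all $n\ge m\ge 1$, where $\langle\,\cdot\,\rangle_{R_n}$ denotes the ideal of $R_n$ generated by a set and $\mathrm{Inc}_{m,n}(I_m)=\{\pi(f)\mid \pi\in\mathrm{Inc}_{m,n},\ f\in I_m\}$. It is a known theorem (Cohen; Hillar--Sullivant) that such a chain stabilizes: there is $r$ with equality $\langle \mathrm{Inc}_{m,n}(I_m)\rangle_{R_n}= I_n$ for all $n\ge m\ge r$; the smallest such $r$ is the stability index $\operatorname{ind}(\mathcal{I})$. The chain is nonzero if $I_n\ne 0$ for some $n$; it is a chain of proper monomial ideals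 if every $I_n\ne R_n$ is a monomial ideal. For a nonzero proper monomial ideal $J\subsetneq R_n$ let $G(J)$ be its minimal set of monomial generators. For a monomial $u=x_1^{a_1}\cdots x_n^{a_n}\neq 1$ put $w(u)=\max\{a_i\mid 1\le i\le n\}$, and let $w(J)=\min\{w(u)\mid u\in G(J)\}$. For a chain $\mathcal{I}$ with $r=\operatorname{ind}(\mathcal{I})$ put $w(\mathcal{I})=w(I_r)$. Castelnuovo--Mumford regularity $\operatorname{reg} I_n$ is taken over $R_n$ with the standard grading. *)

(* Defs.v *)
From mathcomp Require Import all_boot all_order all_algebra.
From mathcomp Require Import boolp classical_sets.
From mathcomp Require Import mpoly.

Set Implicit Arguments.
Unset Strict Implicit.
Unset Printing Implicit Defensive.

Import GRing.Theory.

Local Open Scope classical_set_scope.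
Local Open Scope ring_scope.

(* Indexing.  The variable x_i of the mathematics (i >= 1) is the variable
   'X_(i-1) of {mpoly K[n]}, and a map pi of the positive integers is encoded
   by k |-> pi (k + 1) - 1 on nat.  A chain is a family indexed by nat whose
   member at index 0 is never constrained nor used. *)

Definition nat_min (A : set nat) : nat :=
  xget 0%N [set k | A k /\ forall l, A l -> (k <= l)%N].

Definition nat_max (A : set nat) : nat :=
  xget 0%N [set k | A k /\ forall l, A l -> (l <= k)%N].

Section Ideals.
Context {K : fieldType} {n : nat}.
Implicit Types (J S : set {mpoly K[n]}) (u : 'X_{1..n}) (G : set 'X_{1..n}).

Definition is_ideal J : Prop :=
  [/\ J 0,
      forall f g, J f -> J g -> J (f + g)
    & forall f g, J g -> J (f * g)].

Definition ideal_gen S : set {mpoly K[n]} := smallest is_ideal S.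

Definition monomial_gen G : set {mpoly K[n]} :=
  ideal_gen [set ('X_[u] : {mpoly K[n]}) | u in G].

Definition is_monomial_ideal J : Prop := exists G, J = monomial_gen G.

Definition is_minimal_generating_set J G : Prop :=
  J = monomial_gen G /\
  forall G', G' `<=` G -> J = monomial_gen G' -> G' = G.

Definition min_gens J : set 'X_{1..n} :=
  xget set0 (is_minimal_generating_set J).

Definition weight u : nat := \max_(i < n) u i.

Definition ideal_weight J : nat := nat_min [set weight u | u in min_gens J].

End Ideals.

Section Regularity.
Context {K : fieldType} {n : nat}.

(* ... -> F_2 -> F_1 -> F_0 -> {mpoly K[n]}, where F_i is free of rank
   [rk i] with a basis of elements of degrees [sh i p].  Elements of F_i are
   row vectors and maps act by right multiplication. *)
Record free_complex := FreeComplex {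
  rk : nat -> nat;
  sh : forall i, 'I_(rk i) -> nat;
  aug : 'cV[{mpoly K[n]}]_(rk 0);
  dif : forall i, 'M[{mpoly K[n]}]_(rk i.+1, rk i)
}.

Definition is_graded (F : free_complex) : Prop :=
  (forall p, aug F p ord0 \is (sh p).-homog) /\
  (forall i (p : 'I_(rk F i.+1)) (q : 'I_(rk F i)),
     dif F i p q = 0 \/
     exists2 k, sh p = (sh q + k)%N & dif F i p q \is k.-homog).

Definition is_resolution (J : set {mpoly K[n]}) (F : free_complex) : Prop :=
  [/\ forall f, J f <-> exists u : 'rV_(rk F 0), (u *m aug F) ord0 ord0 = f,
      forall u : 'rV_(rk F 0),
        u *m aug F = 0 <-> exists v : 'rV_(rk F 1), u = v *m dif F 0
    & forall i (u : 'rV_(rk F i.+1)),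
        u *m dif F i = 0 <-> exists v : 'rV_(rk F i.+2), u = v *m dif F i.+1].

(* The differentials map F_(i+1) into (x_1, ..., x_n) F_i. *)
Definition is_minimal (F : free_complex) : Prop :=
  forall i p q, (dif F i p q)@_0%MM = 0.

Definition minimal_graded_free_resolution (J : set {mpoly K[n]})
    (F : free_complex) : Prop :=
  [/\ is_graded F, is_resolution J F & is_minimal F].

Definition betti (F : free_complex) (i j : nat) : nat :=
  #|[set p : 'I_(rk F i) | sh p == j]%SET|.

(* max {j - i | beta_(i,j) <> 0}.  Since resolutions are minimal, the union
   over all of them is the set obtained from any single one; moreover
   generators of F_i have degree at least i, so that r ranges over nat. *)
Definition regularity (J : set {mpoly K[n]}) : nat :=
  nat_max [set r | exists2 F, minimal_graded_free_resolution J F &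
                     exists i, betti F i (i + r) != 0%N].

End Regularity.

Section Chains.
Context {K : fieldType}.

Definition is_Inc (pi : nat -> nat) : Prop :=
  forall i j, (i < j)%N -> (pi i < pi j)%N.

(* For m >= 1; [pi m.-1 < n] is the condition pi(m) <= n after the index
   shift. *)
Definition Inc_mn (m n : nat) : set (nat -> nat) :=
  [set pi | is_Inc pi /\ (pi m.-1 < n)%N].

(* The action of pi as a map R_m -> R_n; the default value 0 is not reached
   when pi belongs to [Inc_mn m n]. *)
Definition inc_act (m n : nat) (pi : nat -> nat) (f : {mpoly K[m]}) :
    {mpoly K[n]} :=
  f \mPo [tuple (if insub (pi i) is Some j then 'X_(j : 'I_n) else 0) | i < m].

Definition inc_image (m n : nat) (J : set {mpoly K[m]}) : set {mpoly K[n]} :=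
  [set g | exists2 pi, Inc_mn m n pi & exists2 f, J f & g = inc_act n pi f].
Arguments inc_image {m} n J _.

Implicit Types I : forall n : nat, set {mpoly K[n]}.

Definition Inc_invariant I : Prop :=
  forall m n, (1 <= m <= n)%N -> ideal_gen (inc_image n (I m)) `<=` I n.

Definition stable_from I (r : nat) : Prop :=
  (1 <= r)%N /\
  forall m n, (r <= m <= n)%N -> ideal_gen (inc_image n (I m)) = I n.

Definition stability_index I : nat := nat_min [set r | stable_from I r].

Definition chain_weight I : nat := ideal_weight (I (stability_index I)).

Definition chain_nonzero I : Prop :=
  exists n, (1 <= n)%N /\ exists2 f, I n f & f != 0.

End Chains.

(* Main.v *)
Require Import Defs.
From mathcomp Require Import all_boot all_order all_algebra mpoly.
From mathcomp Require Import boolp classical_sets reals topology normedtype.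
From mathcomp Require Import sequences.
From mathcomp Require Import zify.
Import GRing.Theory Num.Theory numFieldNormedType.Exports.

Set Implicit Arguments.
Unset Strict Implicit.
Unset Printing Implicit Defensive.

Local Open Scope classical_set_scope.
Local Open Scope ring_scope.
(** Write w for the weight of the chain.  The theorem follows from
(w - 1) n - C <= reg I_n <= (w - 1) n + C for n large, with C constant.

Regularity is combinatorial.  The Betti number beta_(i,j) of any minimal graded
free resolution of a monomial ideal J is nonzero exactly when, for some exponent
b of total degree j, the Koszul complex K^b = {s | s <= b and x^(b-s) in J}, a
simplicial complex on the variables, has nonzero homology carried by faces with
i vertices ([betti_koszul], [koszul_monomial_ideal]).  This compares Tor computed
from the resolution with Tor computed from the Koszul complex, by shifting
dimensions along the syzygy modules ([dimension_shift]).  The same shift shows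
that each syzygy module has its minimal generators in bounded degrees, which is
why a minimal resolution by finite free modules exists
([minimal_graded_generators], [syzygy_resolutionP]).

Upper bound ([koszul_homology_upper]).  If K^b has homology on faces with i
vertices then, for each variable k, some such face s misses k and s + k is not
a face, since otherwise coning from k kills every cycle.  Let u be a monomial of
the chain all of whose exponents are at most w, on r variables.  By
Inc-invariance a monomial with exponents at least w in r places is divisible by
a translate of u.  Hence fewer than r places have b_k > w, and the number of
places with b_k >= w is at most i + r.  As the entries of b are bounded by the
exponents of the generators, |b| - i <= (w - 1) n + C.

Lower bound ([koszul_homology_lower], [regularity_lower]).  Among the monomials
of the chain with exponents at most w take one, a w c as a word of exponents,
with the fewest letters w, and let b = a w ... w c.  On the set M of the middle
places the faces of K^b are exactly the proper subsets of M: the translates of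
a w c give the facets, and M itself is excluded because a (w-1) ... (w-1) c has
fewer letters w.  So the part of K^b on M is the boundary of a simplex.  Its
homology survives, after changing b outside M only, when the remaining variables
are put back ([homology_extend]), which gives |b| - i >= w |M| - |M| + 1 with
|M| = n - const.

Stability and the bound on the exponents of all generators come from Higman's
lemma for words of natural numbers ([higman], [stable_exists]). *)

(** * The Koszul differential and simplicial homology *)

Section KoszulDifferential.
Context {A : comPzRingType} {n : nat}.
Implicit Types (s t : {set 'I_n}) (k l : 'I_n).

(** The sign of removing the vertex [k] from the oriented simplex [k |: s]. *)
Definition ksgn k s : A := (-1) ^+ #|[set l in s | (l < k)%N]|%SET.

Lemma ksgnU1 k l s : l \notin s ->
  ksgn k (l |: s)%SET = (if (l < k)%N then -1 else 1) * ksgn k s.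
Proof.
move=> ls; rewrite /ksgn; case: ifP => lk.
- rewrite -exprS (_ : [set i in l |: s | (i < k)%N]%SET = (l |: [set i in s | (i < k)%N])%SET).
    by rewrite cardsU1 !inE (negbTE ls).
  by apply/setP => i; rewrite !inE; case: (i =P l) => // ->; rewrite lk.
- rewrite mul1r (_ : [set i in l |: s | (i < k)%N]%SET = [set i in s | (i < k)%N]%SET)//.
  by apply/setP => i; rewrite !inE; case: (i =P l) => // ->; rewrite lk !andbF.
Qed.

Lemma ksgn_sqr k s : ksgn k s * ksgn k s = 1.
Proof. by rewrite /ksgn -expr2 sqrr_sign. Qed.

Lemma ksgn_anticomm k l s : k != l -> k \notin s -> l \notin s ->
  ksgn l (k |: s)%SET * ksgn k (l |: s)%SET = - (ksgn k s * ksgn l s).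
Proof.
move=> kl ks ls; rewrite !ksgnU1//.
have [kl'|lk|/val_inj e] := ltngtP k l; last by rewrite e eqxx in kl.
  by rewrite mul1r mulN1r mulNr mulrC.
by rewrite mul1r mulN1r mulrN mulrC.
Qed.

Lemma ksgn_swap k l s : k != l -> k \notin s -> l \notin s ->
  ksgn k s * ksgn l (k |: s)%SET = - (ksgn l s * ksgn k (l |: s)%SET).
Proof.
move=> kl ks ls; rewrite !ksgnU1//.
have [kl'|lk|/val_inj e] := ltngtP k l; last by rewrite e eqxx in kl.
  by rewrite mul1r mulN1r mulrN mulrC.
by rewrite mul1r mulN1r mulrN opprK mulrC.
Qed.

Context {V : lmodType A}.
Implicit Types (x : 'I_n -> A) (z : {set 'I_n} -> V).

(** The weights [x] make one definition serve twice: with the variables of the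
polynomial ring it is the Koszul differential, with all weights 1 it is the
simplicial boundary.  Chains are functions on all subsets of the vertices, so
that no bookkeeping of dimensions is built in. *)
Definition kdiff x z s : V :=
  \sum_(k | k \notin s) (ksgn k s * x k) *: z (k |: s)%SET.

(** The two orders of removing a pair of vertices cancel.  Splitting the double
sum according to the order of the pair, instead of dividing by 2, keeps
characteristic 2 included. *)
Lemma kdiff_sqr x z s : kdiff x (kdiff x z) s = 0.
Proof.
rewrite /kdiff.
pose F k l := ((ksgn k s * x k) * (ksgn l (k |: s)%SET * x l)) *:
  z (l |: (k |: s))%SET.
have FN k l : k != l -> k \notin s -> l \notin s -> F k l = - F l k.
  move=> kl ks ls; rewrite /F finset.setUCA -scaleNr; congr (_ *: _).
  rewrite mulrACA (mulrACA (ksgn l s)) ksgn_swap// mulNr.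
  by rewrite (mulrC (x k)).
rewrite (eq_bigr (fun k => \sum_(l | (l \notin s) && (k < l)%N) F k l +
                           \sum_(l | (l \notin s) && (l < k)%N) F k l)); last first.
  move=> k ks; rewrite scaler_sumr (bigID (fun l : 'I_n => (k < l)%N)) /=.
  congr (_ + _); apply: eq_big => [l|l _]; rewrite ?scalerA// !inE negb_or.
  - by case: (l =P k) => [->|]; rewrite ?ltnn ?andbF.
  - rewrite -leqNgt leq_eqVlt -(inj_eq val_inj) /=.
    by case: (_ =P _) => [->|]; rewrite /= ?ltnn ?andbF.
rewrite big_split /= (exchange_big_dep (fun l => l \notin s)) /=; last by move=> i j _ /andP[].
rewrite -big_split big1 // => l ls /=.
apply/eqP; rewrite addr_eq0 -sumrN; apply/eqP.
apply: eq_big => k; first by rewrite ls.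
move=> /and3P[ks _ kl]; apply: FN => //; apply/eqP => e; by rewrite e ltnn in kl.
Qed.

Lemma kdiffD x z z' s : kdiff x (fun t => z t + z' t) s = kdiff x z s + kdiff x z' s.
Proof. by rewrite /kdiff -big_split; apply: eq_bigr => k _; rewrite scalerDr. Qed.

Lemma kdiffB x z z' s : kdiff x (fun t => z t - z' t) s = kdiff x z s - kdiff x z' s.
Proof. by rewrite /kdiff -sumrB; apply: eq_bigr => k _; rewrite scalerBr. Qed.

Lemma eq_kdiff x z z' : z =1 z' -> kdiff x z =1 kdiff x z'.
Proof. by move=> e s; apply: eq_bigr => k _; rewrite e. Qed.

End KoszulDifferential.

Section SimplicialHomology.
Context {K : fieldType} {n : nat}.
Implicit Types (s t : {set 'I_n}) (k l : 'I_n) (c d : {set 'I_n} -> K^o).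

Definition bd c : {set 'I_n} -> K^o := kdiff (fun _ => 1) c.

Lemma bdE c s : bd c s = \sum_(k | k \notin s) ksgn k s * c (k |: s)%SET.
Proof. by apply: eq_bigr => k _; rewrite mulr1. Qed.

(** Adding the vertex [k] to every face: a contracting homotopy of the full
simplex. *)
Definition cone k c s : K^o :=
  if k \in s then ksgn k (s :\ k)%SET * c (s :\ k)%SET else 0.

Lemma cone_homotopy k c s : bd (cone k c) s + cone k (bd c) s = c s.
Proof.
rewrite bdE {2}/cone; case: ifPn => [ks|ks]; last first.
  rewrite addr0 (bigD1 k)//= big1 => [|l /andP[ls lk]]; last first.
    by rewrite /cone !inE eq_sym (negbTE lk) (negbTE ks) mulr0.
  by rewrite /cone setU11 addr0 setU1K// mulrA ksgn_sqr mul1r.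
set t := (s :\ k)%SET; have kt : k \notin t by rewrite !inE eqxx.
have es : s = (k |: t)%SET by rewrite finset.setD1K.
clearbody t.
rewrite bdE (bigD1 k kt)/= -es mulrDr mulrA ksgn_sqr mul1r.
rewrite addrC -addrA -[RHS]addr0; congr (_ + _).
rewrite mulr_sumr es.
apply/eqP; rewrite addr_eq0 -sumrN; apply/eqP.
apply: eq_big => l; first by rewrite !inE negb_or andbC.
move=> /andP[lt lk]; rewrite /cone !inE eqxx orbT.
have e : ((l |: (k |: t)) :\ k = l |: t)%SET.
  by apply/setP => i; rewrite !inE; case: (i =P k) => [->|]//=;
    rewrite eq_sym (negbTE lk) (negbTE kt).
by rewrite e !mulrA -mulNr ksgn_anticomm ?opprK// eq_sym.
Qed.

(** Nonzero reduced homology of the complex [X], carried by faces with [i]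
vertices, that is, in dimension [i - 1].  A bounding chain need not be
homogeneous. *)
Definition has_homology (X : {set 'I_n} -> Prop) i : Prop :=
  exists c, [/\ forall s, c s != 0 -> X s /\ #|s| = i,
                forall s, bd c s = 0
              & ~ exists d, (forall s, d s != 0 -> X s) /\ forall s, bd d s = c s].

(** Otherwise the cone from [k] over any cycle on faces with [i] vertices would
stay in [X] and bound that cycle. *)
Lemma has_homology_no_cone X i k : has_homology X i ->
  exists s, [/\ X s, #|s| = i, k \notin s & ~ X (k |: s)%SET].
Proof.
move=> [c [cX c0 cN]]; apply: contrapT => H; apply: cN; exists (cone k c); split.
- move=> s; rewrite /cone; case: ifPn => ks; rewrite ?eqxx// mulf_eq0 negb_or.
  move=> /andP[_ /cX[Xs si]]; rewrite -(finset.setD1K ks).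
  apply: contrapT => NX; apply: H; exists (s :\ k)%SET; split => //.
  by rewrite !inE eqxx.
- move=> s; rewrite -[RHS](cone_homotopy k) [cone k (bd c) s](_ : _ = 0) ?addr0//.
  by rewrite /cone; case: ifP => // _; rewrite c0 mulr0.
Qed.

(** The cycle is the boundary of the missing simplex [M]; it is nonzero on each
facet, and no face of [X] is big enough to bound it. *)
Lemma has_homology_simplex_boundary (X : {set 'I_n} -> Prop) (M : {set 'I_n}) :
  M != finset.set0 ->
  (forall s, X s <-> (s \proper M)%SET) -> has_homology X #|M|.-1.
Proof.
move=> /set0Pn[k kM] XP; pose c0 : {set 'I_n} -> K^o := fun s => (s == M)%:R.
exists (bd c0); split.
- move=> s; rewrite bdE => H.
  have [l ls] : exists2 l, l \notin s & (l |: s)%SET == M.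
    apply: contrapT => N; move/eqP: H; apply; apply: big1 => l ls.
    rewrite /c0; case: eqP => [e|_]; last by rewrite mulr0.
    by exfalso; apply: N; exists l => //; apply/eqP.
  move/eqP => e; rewrite -e cardsU1 ls; split => //; apply/XP; rewrite -e.
  apply: properUr; by rewrite finset.sub1set.
- by move=> s; apply: kdiff_sqr.
- move=> [d [dX dc]]; have := dc (M :\ k)%SET.
  rewrite !bdE big1; last first.
    move=> l lM; have [->|/eqP dn] := d (l |: M :\ k)%SET =P 0; first by rewrite mulr0.
    move/dX: dn => /XP; move: lM; rewrite !inE negb_and negbK.
    case/orP => [/eqP ->|lM]; first by rewrite finset.setD1K// fintype.properxx.
    by move=> /proper_sub /fintype.subsetP/(_ l); rewrite setU11 (negbTE lM) => /(_ isT).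
  rewrite (bigD1 k) ?inE ?eqxx//= finset.setD1K// {1}/c0 eqxx mulr1 big1 ?addr0.
    by move/esym/eqP; rewrite signr_eq0.
  move=> l /andP[lM lk]; rewrite /c0; case: eqP => [e|]; last by rewrite mulr0.
  by move: (kM); rewrite -e !inE eqxx andFb orbF eq_sym (negbTE lk).
Qed.

End SimplicialHomology.
(** * Koszul complexes of monomial ideals in one multidegree *)
Section MultigradedPieces.
Context {K : fieldType} {n : nat}.
Implicit Types (s t V M : {set 'I_n}) (k l e : 'I_n) (c d : {set 'I_n} -> K^o).
Implicit Types (U : 'X_{1..n} -> Prop) (b m : 'X_{1..n}).

Definition mset s : 'X_{1..n} := [multinom (i \in s : nat) | i < n].

Definition upclosed U := forall m m', U m -> (m <= m')%MM -> U m'.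

(** The faces of the upper Koszul complex in multidegree [b] of the monomial ideal
whose monomials have exponents in [U]. *)
Definition face U b s : Prop := (mset s <= b)%MM /\ U (b - mset s)%MM.

Lemma msetE s k : mset s k = (k \in s). Proof. by rewrite mnmE. Qed.

Lemma mdeg_mset s : mdeg (mset s) = #|s|.
Proof.
rewrite mdegE -sum1_card [RHS]big_mkcond; apply: eq_bigr => i _.
by rewrite msetE; case: (i \in s).
Qed.

Lemma mset_setU1 k s : k \notin s -> mset (k |: s)%SET = (U_(k) + mset s)%MM.
Proof.
move=> ks; apply/mnmP => i; rewrite mnmDE mnm1E !msetE !inE eq_sym.
by case: (k =P i) => [<-|]//=; rewrite (negbTE ks).
Qed.

Lemma upclosedB U b s t : upclosed U -> (s \subset t)%SET ->
  U (b - mset t)%MM -> U (b - mset s)%MM.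
Proof.
move=> Uup /fintype.subsetP st /Uup; apply; apply/mnm_lepP => i.
rewrite !mnmBE !msetE leq_sub2l//.
by case is_: (i \in s) => //; rewrite st.
Qed.

Lemma has_homology_iff (X Y : {set 'I_n} -> Prop) i :
  (forall s, X s <-> Y s) -> @has_homology K n X i -> @has_homology K n Y i.
Proof.
move=> XY [c [cX c0 cN]]; exists c; split=> //; first by move=> s /cX; rewrite XY.
by move=> [d [dX dc]]; apply: cN; exists d; split=> // s /dX; rewrite XY.
Qed.

Definition setm b e a : 'X_{1..n} := [multinom if i == e then a else b i | i < n].

(** Let X_a be the complex on [V] obtained from [b] by putting [a] at the vertex
[e]; it grows with [a].  Take the least [a] such that X_a carries a cycle that
does not bound in the complex of [b].  If this cycle bounded once [e] is added,
then the part of the bounding chain on faces through [e] would be a homologous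
cycle in X_(a-1), against minimality. *)
Lemma homology_add_vertex U b V i e : upclosed U -> e \notin V ->
  @has_homology K n (fun s => (s \subset V)%SET /\ face U b s) i ->
  exists2 b' : 'X_{1..n}, (forall k, k != e -> b' k = b k) &
    @has_homology K n (fun s => (s \subset e |: V)%SET /\ face U b' s) i.
Proof.
move=> Uup eV [z0 [z0X z00 z0N]].
pose X a s := (s \subset V)%SET /\ face U (setm b e a) s.
have Xmon a s : (a <= b e)%N -> X a s -> (s \subset V)%SET /\ face U b s.
  have bmon : (a <= b e)%N -> (setm b e a <= b)%MM.
    by move=> ab; apply/mnm_lepP => k; rewrite mnmE; case: eqP => [->|].
  move=> /bmon ab [sV [sb Us]]; split=> //; split; first exact: lepm_trans sb ab.
  apply: Uup Us _; apply/mnm_lepP => k; rewrite !mnmBE leq_sub2r//.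
  by move/mnm_lepP: ab; apply.
have /(_ (b e) (leqnn _)) main : forall a, (a <= b e)%N ->
  (exists z, [/\ forall s, z s != 0 -> X a s /\ #|s| = i, forall s, bd z s = 0 &
   ~ exists d, (forall s, d s != 0 -> (s \subset V)%SET /\ face U b s) /\
               forall s, @bd K n d s = z s]) ->
  exists a', @has_homology K n
     (fun s => (s \subset e |: V)%SET /\ face U (setm b e a') s) i; last first.
  case: main => [|a' Ha']; last first.
    by exists (setm b e a') => // k ke; rewrite mnmE (negbTE ke).
  exists z0; split => // s /z0X[[sV fs] si]; split=> //; split=> //.
  rewrite (_ : setm b e (b e) = b)//; apply/mnmP => k; rewrite mnmE.
  by case: eqP => // ->.
(* Faces through [e] in the bounding chain are recorded, without [e], by [y1]. *)
have split_off a z : (forall s, z s != 0 -> X a s /\ #|s| = i) ->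
    (forall s, bd z s = 0) ->
    ~ @has_homology K n (fun s => (s \subset e |: V)%SET /\ face U (setm b e a) s) i ->
    exists y0 y1, [/\ forall s, y0 s != 0 -> X a s,
      forall s, y1 s != 0 -> [/\ e \notin s, (s \subset V)%SET, #|s| = i
                             & face U (setm b e a) (e |: s)%SET]
      & forall s, z s = @bd K n y0 s + y1 s].
  move=> zX z_0 noH.
  have [y [yX yz]] : exists y, (forall s, y s != 0 ->
      ((s \subset e |: V)%SET /\ face U (setm b e a) s)) /\
      forall s, @bd K n y s = z s.
    apply: contrapT => N; apply: noH; exists z; split=> // s /zX[[sV fs] si].
    by split=> //; split=> //; apply: fintype.subset_trans sV (finset.subsetUr _ _).
  pose y0 : {set 'I_n} -> K^o := fun s =>
    if (e \notin s) && (#|s| == i.+1) then y s else 0.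
  pose y1 : {set 'I_n} -> K^o := fun s =>
    if (e \notin s) && (#|s| == i) then ksgn e s * y (e |: s)%SET else 0.
  exists y0, y1; split=> [s|s|s].
  - rewrite /y0; case: ifP => [/andP[es _] /yX[/fintype.subsetP sV fs]|]; last by rewrite eqxx.
    split=> //; apply/fintype.subsetP => k ks; have := sV k ks; rewrite !inE.
    by case: eqP ks => [->|]//; rewrite (negbTE es).
  - rewrite /y1; case: ifP => [/andP[es /eqP si]|]; last by rewrite eqxx.
    rewrite mulf_eq0 negb_or => /andP[_ /yX[/fintype.subsetP sV fs]]; split=> //.
    apply/fintype.subsetP => k ks; have := sV k; rewrite !inE ks orbT => /(_ isT).
    by case: eqP ks => [->|]//; rewrite (negbTE es).
  - have [es|es] := boolP (e \in s).
      rewrite /y1 es addr0 bdE big1.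
        apply/eqP/negPn/negP => /zX[[/fintype.subsetP/(_ e es)]].
        by rewrite (negbTE eV).
      by move=> k _; rewrite /y0 !inE es orbT mulr0.
    have [si|/eqP si] := #|s| =P i; last first.
      rewrite /y1 (negbTE si) andbF addr0 bdE big1.
        by apply/eqP/negPn/negP => /zX[_ /eqP]; rewrite (negbTE si).
      move=> k ks; rewrite /y0 cardsU1 ks add1n eqSS (negbTE si) andbF.
      by rewrite mulr0.
    rewrite -yz !bdE /y1 es si eqxx /= (bigD1 e)//= addrC; congr (_ + _).
    rewrite [RHS](bigD1 e)//= {1}/y0 !inE eqxx /= mulr0 add0r.
    apply: eq_bigr => k /andP[ks ke].
    by rewrite /y0 !inE negb_or eq_sym ke es cardsU1 ks si eqxx.
elim=> [|a IHa] ab [z [zX z_0 zN]]; apply: contrapT => noH.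
- have [|y0 [y1 [y0X y1X zE]]] := split_off 0%N z zX z_0.
    by move=> H; apply: noH; exists 0%N.
  apply: zN; exists y0; split=> [s /y0X /(Xmon _ _ ab)//|s].
  rewrite zE; have [->|/eqP/y1X[es _ _ [/mnm_lepP/(_ e)]]] := y1 s =P 0;
    first by rewrite addr0.
  by rewrite msetE !inE eqxx mnmE eqxx.
- have [|y0 [y1 [y0X y1X zE]]] := split_off a.+1 z zX z_0.
    by move=> H; apply: noH; exists a.+1.
  have y1E s : y1 s = z s - bd y0 s by rewrite zE addrC addKr.
  apply: noH; apply: IHa; first exact: ltnW.
  exists y1; split=> [s /y1X[es sV si [sb Us]]|s|[d [dX dy]]].
  + split=> //; split=> //.
    have E : (setm b e a.+1 - mset (e |: s) = setm b e a - mset s)%MM.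
      apply/mnmP => k; rewrite !mnmBE !mnmE !inE.
      by case: (k =P e) => [->|]//=; rewrite (negbTE es) subSS.
    split; last by rewrite -E.
    apply/mnm_lepP => k; move/mnm_lepP/(_ k): sb.
    by rewrite !mnmE !inE; case: (k =P e) => [->|]//=; rewrite (negbTE es).
  + rewrite /bd (eq_kdiff _ y1E) kdiffB; rewrite -!/(bd _) z_0 /bd kdiff_sqr.
    by rewrite subr0.
  + apply: zN; exists (fun s => y0 s + d s); split=> s; last first.
      by rewrite /bd kdiffD -!/(bd _) dy zE.
    have [/eqP y00|/eqP/y0X/(Xmon _ _ ab)//] := y0 s =P 0.
    by rewrite (eqP y00) add0r => /dX.
Qed.

(** All vertices outside [V] are added one at a time; only entries of the
multidegree outside [V] are changed. *)
Lemma homology_extend U b V i : upclosed U ->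
  @has_homology K n (fun s => (s \subset V)%SET /\ face U b s) i ->
  exists2 b' : 'X_{1..n}, (forall k, k \in V -> b' k = b k) &
    @has_homology K n (face U b') i.
Proof.
move=> Uup; move En : #|(~: V)%SET| => N.
elim: N V b En => [|N IHN] V b En H.
  exists b => //; apply: has_homology_iff H => s; split=> [[]//|]; split=> //.
  move/eqP: En; rewrite cards_eq0 => /eqP VT.
  by rewrite -(finset.setCK V) VT finset.setC0 finset.subsetT.
have /card_gt0P[e] : (0 < #|(~: V)%SET|)%N by rewrite En.
rewrite inE => eV; have [b1 b1E H1] := homology_add_vertex Uup eV H.
have [|b2 b2E H2] := IHN (e |: V)%SET b1 _ H1.
  move: En; rewrite (cardsD1 e) inE eV add1n => -[<-].
  by apply: eq_card => k; rewrite !inE negb_or.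
exists b2 => // k kV; rewrite b2E ?inE ?kV ?orbT// b1E//.
by apply: contraNneq eV => <-.
Qed.

(** The hypotheses say that the proper subsets of [M] are the faces on [M]. *)
Lemma koszul_homology_lower U b M : upclosed U -> M != finset.set0 ->
  (forall k, k \in M -> 0 < b k)%N ->
  (forall k, k \in M -> U (b - mset (M :\ k)%SET)%MM) ->
  ~ U (b - mset M)%MM ->
  exists2 b' : 'X_{1..n}, (forall k, k \in M -> b' k = b k) &
    @has_homology K n (face U b') #|M|.-1.
Proof.
move=> Uup M0 bM UM UMN; apply: (homology_extend Uup).
apply: has_homology_simplex_boundary => // s; split.
  move=> [sM [_ Us]]; rewrite finset.properEneq sM andbT.
  by apply: contra_notN UMN => /eqP <-.
move=> /[dup] /proper_sub sM /fintype.properP[_ [k kM ks]]; split=> //; split.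
  apply/mnm_lepP => l; rewrite msetE; case ls: (l \in s) => //.
  by apply: bM; apply: (fintype.subsetP sM).
apply: (upclosedB Uup _ (UM k kM)).
by rewrite finset.subsetD1 sM.
Qed.

(** [HW] holds when some monomial in [r] variables with exponents at most [w] can
be placed at any [r] positions, [HD] when the generators have exponents at most
[D].  Each assertion about [b] comes from a face [s] and a vertex [k] such that
[k |: s] is not a face: if [b k > D], the exponent at [k] could be lowered; if at
least [r] entries of [b] exceed [w], every subset of the support is a face; and
subsets of the support leaving [r] positions of W uncovered are faces. *)
Lemma koszul_homology_upper U b i w r D : (0 < w)%N ->
  (forall m (A : {set 'I_n}), (r <= #|A|)%N -> (forall k, k \in A -> w <= m k)%N -> U m) ->
  (forall m k, U m -> (D < m k)%N -> U (m - U_(k))%MM) ->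
  @has_homology K n (face U b) i ->
  (mdeg b <= i + w.-1 * n + (r + r * D))%N /\ forall k, (b k <= D)%N.
Proof.
move=> w0 HW HD H.
have no_cone k : exists s, [/\ (mset s <= b)%MM, U (b - mset s)%MM, #|s| = i, k \notin s
    & ((0 < b k)%N -> ~ U (b - mset (k |: s)%SET)%MM)].
  have [s [[sle Us] si ks N]] := has_homology_no_cone k H.
  exists s; split=> // bk Uk; apply: N; split=> //.
  apply/mnm_lepP => l; rewrite msetE !inE.
  by case: eqP => [->|_]//=; move/mnm_lepP/(_ l): sle; rewrite msetE.
have bD k : (b k <= D)%N.
  rewrite leqNgt; apply/negP => Dk; have [s [_ Us _ ks]] := no_cone k.
  apply; first exact: leq_ltn_trans Dk.
  rewrite mset_setU1// addmC -submDA; apply: HD => //.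
  by rewrite mnmBE msetE (negbTE ks) subn0.
split=> //.
pose V := [set k | (w < b k)%N]%SET; pose W := [set k | (w <= b k)%N]%SET.
have Vr : (#|V| <= r)%N.
  rewrite leqNgt; apply/negP => rV.
  have /card_gt0P[k] : (0 < #|V|)%N by apply: leq_ltn_trans rV.
  rewrite inE => wk; have [s [_ _ _ ks]] := no_cone k.
  apply; first exact: leq_ltn_trans wk.
  apply: (HW _ V (ltnW rV)) => l; rewrite inE mnmBE msetE => wl.
  by case: (l \in _); rewrite ?subn0 ?(ltnW wl)// subn1 -ltnS prednK// (leq_ltn_trans _ wl).
have Wi : (#|W| <= i + r)%N.
  have [W0|] := leqP #|W| 0; first by move: W0; rewrite leqn0 => /eqP ->.
  move=> /card_gt0P[k]; rewrite inE => wk; have [s [_ _ si ks N]] := no_cone k.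
  rewrite leqNgt; apply/negP => Wir; apply: N; first exact: leq_trans wk.
  apply: (HW _ (W :\: (k |: s))%SET).
    have : (#|W :&: (k |: s)| <= i.+1)%SET%N.
      have -> : (i.+1 = #|k |: s|)%SET%N by rewrite cardsU1 ks si.
      exact/subset_leq_card/finset.subsetIr.
    move=> h1; have h2 := cardsID (k |: s)%SET W.
    rewrite -(leq_add2l i.+1) addSn (leq_trans Wir)// -h2.
    by rewrite leq_add2r.
  move=> l; rewrite finset.in_setD [in X in _ && X]inE => /andP[ls wl].
  by rewrite mnmBE msetE (negbTE ls) subn0.
(* An entry is at most [w - 1], one more on W, and at most [D] more on V. *)
have : (mdeg b <= \sum_(k < n) (w.-1 + ((k \in W) + (k \in V) * D)))%N.
  rewrite mdegE; apply: leq_sum => k _; rewrite !inE; have := bD k.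
  case: ltngtP => //=; lia.
rewrite !big_split /= -big_distrl /= sum_nat_const card_ord.
rewrite -!big_mkcond /= !sum1_card.
have : (#|V| * D <= r * D)%N by rewrite leq_mul2r Vr orbT.
rewrite mulnC; set x := (_ * D)%N; lia.
Qed.

End MultigradedPieces.
(** * Koszul complexes of free modules *)
Section KoszulModules.
Context {K : fieldType} {n : nat}.
Local Notation Rn := {mpoly K[n]}.
Implicit Types (s t : {set 'I_n}) (U : 'X_{1..n} -> Prop) (b m : 'X_{1..n}).

Lemma mcoeff_Xmul (k : 'I_n) (q : Rn) m :
  ('X_k * q)@_m = if (0 < m k)%N then q@_(m - U_(k)) else 0.
Proof.
rewrite mulrC; case: ifPn => [mk|mk].
  by rewrite -[in LHS](@submK _ U_(k) m) ?lep1mP -?lt0n// addmC mcoeffMX.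
apply/eqP; rewrite mcoeff_eq0 (perm_mem (msuppMX _ _)); apply: contra mk.
by move=> /mapP[m' _ ->]; rewrite mnmDE mnm1E eqxx.
Qed.

Lemma mcoeff_sgnX (k : 'I_n) s (q : Rn) m :
  (ksgn k s * 'X_k * q)@_m =
  ksgn k s * (if (0 < m k)%N then q@_(m - U_(k)) else 0).
Proof.
rewrite -mcoeff_Xmul -mulrA -mcoeffCM; congr ((_ * _)@_m).
by rewrite /ksgn rmorphXn /= mpolyCN mpolyC1.
Qed.

Context {k : nat}.
Implicit Types (z y : {set 'I_n} -> 'rV[Rn]_k) (p : 'I_k).

Definition koszul z := kdiff (fun i => 'X_i : Rn) z.

Lemma koszulE z s p :
  koszul z s 0 p = \sum_(i | i \notin s) ksgn i s * 'X_i * z (i |: s)%SET 0 p.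
Proof. by rewrite /koszul /kdiff summxE; apply: eq_bigr => i _; rewrite mxE. Qed.

(** The piece of multidegree [b] of the [p]-th component of a Koszul chain, as a
simplicial chain: a monomial of exponent [m] at the face [s] has multidegree
[m + s]. *)
Definition mgpart p b z s : K^o :=
  if (mset s <= b)%MM then (z s 0 p)@_(b - mset s) else 0.

Lemma mgpart_inj z z' : (forall p b s, mgpart p b z s = mgpart p b z' s) -> z =1 z'.
Proof.
move=> H s; apply/rowP => p; apply/mpolyP => m.
by have := H p (m + mset s)%MM s; rewrite /mgpart lem_addl addmK.
Qed.

Lemma mset_setU1_le i s b : i \notin s ->
  (mset (i |: s)%SET <= b)%MM = (mset s <= b)%MM && (0 < (b - mset s)%MM i)%N.
Proof.
move=> is_; rewrite mset_setU1//; apply/idP/andP => [/mnm_lepP H|[/mnm_lepP H bi]].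
  split; first by apply/mnm_lepP => l; apply: leq_trans (H l); rewrite mnmDE leq_addl.
  by have := H i; rewrite mnmDE mnm1E eqxx mnmBE msetE (negbTE is_) subn0.
apply/mnm_lepP => l; rewrite mnmDE mnm1E; case: eqP => [<-|_]; last exact: H.
by move: bi; rewrite mnmBE !msetE (negbTE is_) subn0.
Qed.

Lemma mgpart_koszul p b z s : mgpart p b (koszul z) s = bd (mgpart p b z) s.
Proof.
rewrite bdE /mgpart; case: ifPn => [sb|sb]; last first.
  rewrite big1// => i is_; rewrite mset_setU1_le// (negbTE sb) mulr0//.
rewrite koszulE raddf_sum /=; apply: eq_bigr => i is_.
rewrite mcoeff_sgnX mset_setU1_le// sb /=; case: ifP => // _.
by rewrite mset_setU1// addmC submDA.
Qed.

(** A Koszul chain has finitely many nonzero multigraded pieces, so chains bounding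
the pieces can be put together.  With [U p] everything this serves free modules,
with [U p] the exponents of a monomial ideal it serves that ideal. *)
Lemma koszul_assemble (U : 'I_k -> 'X_{1..n} -> Prop) z :
  (forall p b, exists d, (forall s, d s != 0 -> face (U p) b s) /\
                         forall s, @bd K n d s = mgpart p b z s) ->
  exists y, (forall s, koszul y s = z s) /\
            forall s p m, (y s 0 p)@_m != 0 -> U p m.
Proof.
move=> H.
pose N := (\sum_s \sum_p (msize (z s 0%R p) + #|s|))%N.
have zN p b s : (N <= mdeg b)%N -> mgpart p b z s = 0.
  move=> Nb; rewrite /mgpart; case: ifP => // sb; apply: memN_msupp_eq0.
  apply: msize_mdeg_ge; rewrite -(leq_add2r #|s|) -(mdeg_mset s) -mdegD submK//.
  apply: leq_trans Nb; rewrite mdeg_mset /N (bigD1 s)//= (bigD1 p)//= -addnA leq_addr//.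
have {H} H p b : exists d, [/\ forall s, d s != 0 -> face (U p) b s,
    forall s, @bd K n d s = mgpart p b z s & (N <= mdeg b)%N -> forall s, d s = 0].
  have [Nb|Nb] := leqP N (mdeg b).
    exists (fun=> 0); split=> // s; rewrite ?eqxx// zN// bdE big1// => i _.
    by rewrite mulr0.
  by have [d [dU dz]] := H p b; exists d; split.
have /choice [D HD] : forall pb : 'I_k * 'X_{1..n}, exists d,
    [/\ forall s, d s != 0 -> face (U pb.1) pb.2 s,
    forall s, @bd K n d s = mgpart pb.1 pb.2 z s & (N <= mdeg pb.2)%N -> forall s, d s = 0].
  by move=> [p b]; exact: H.
pose y s : 'rV[Rn]_k := \row_p
  \sum_(m : 'X_{1..n < N}) (D (p, m + mset s)%MM s) *: 'X_[m].
have yE s p m : (y s 0 p)@_m = D (p, m + mset s)%MM s.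
  rewrite mxE; have [mN|mN] := ltnP (mdeg m) N.
    exact: (@mcoeff_mpoly _ _ (fun m => D (p, m + mset s)%MM s)).
  have [_ _ ->] := HD (p, m + mset s)%MM; last first.
    by rewrite /= mdegD (leq_trans mN) ?leq_addr.
  rewrite raddf_sum /= big1// => m' _; rewrite mcoeffZ mcoeffX.
  case: eqP => [e|]; last by rewrite mulr0.
  by have := bmdeg m'; rewrite e ltnNge mN.
exists y; split.
- apply: mgpart_inj => p b s; rewrite mgpart_koszul.
  have [dU <- _] := HD (p, b); apply: eq_kdiff => t.
  rewrite /mgpart yE; case: ifPn => [tb|tb]; first by rewrite submK.
  by apply/esym/eqP/negPn/negP => /dU[]; rewrite (negbTE tb).
- move=> s p m; rewrite yE; have [dU _ _] := HD (p, m + mset s)%MM.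
  by move=> /dU[_]; rewrite addmK.
Qed.

(** In a multidegree [b <> 0] the Koszul complex of the ring is a full simplex on
the support of [b], hence contractible; in multidegree 0 only the constant terms
at the empty face remain. *)
Lemma koszul_exact z : (forall s, koszul z s = 0) ->
  (forall p, (z finset.set0 0 p)@_0%MM = 0) -> exists y, forall s, koszul y s = z s.
Proof.
move=> z0 zc; have [p b|y [yz _]] := @koszul_assemble (fun _ _ => True) z; last by exists y.
have cyc s : bd (mgpart p b z) s = 0.
  by rewrite -mgpart_koszul /mgpart z0 mxE mcoeff0 if_same.
have [b0|/eqP] := b =P 0%MM.
  exists (fun=> 0); split=> s; first by rewrite eqxx.
  rewrite bdE big1 => [|i _]; last by rewrite mulr0.
  rewrite /mgpart; case: ifP => // sb.
  have s0 : s = finset.set0.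
    apply/setP => i; rewrite inE; move/mnm_lepP/(_ i): sb.
    by rewrite b0 mnm0E msetE; case: (i \in s).
  rewrite s0 b0 (_ : (_ - _)%MM = 0%MM) ?zc//.
  by apply/mnmP => i; rewrite mnmBE mnm0E sub0n.
rewrite -mdeg_eq0 mdegE sum_nat_eq0 negb_forall => /existsP[i /= bi].
exists (cone i (mgpart p b z)); split=> s.
- rewrite /cone; case: ifP => // [is_|]; last by rewrite eqxx.
  rewrite mulf_eq0 negb_or /mgpart => /andP[_]; case: ifP => [sb _|]; last by rewrite eqxx.
  split=> //; apply/mnm_lepP => l; move/mnm_lepP/(_ l): sb; rewrite !msetE !inE.
  by case: eqP => [->|]//= _; rewrite is_ lt0n.
- rewrite -[RHS](cone_homotopy i) [cone i (bd _) s](_ : _ = 0) ?addr0//.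
  by rewrite /cone cyc mulr0 if_same.
Qed.

End KoszulModules.
(** * Koszul homology of graded submodules *)
Section GradedModules.
Context {K : fieldType} {n : nat}.
Local Notation Rn := {mpoly K[n]}.
Implicit Types (s t : {set 'I_n}) (U : 'X_{1..n} -> Prop) (b m : 'X_{1..n}).
Implicit Types (f : pred 'X_{1..n}) (q : Rn).

(** The terms of [q] whose exponents satisfy [f]: projections to graded pieces. *)
Definition sel f q : Rn := \sum_(m <- msupp q) (if f m then q@_m else 0) *: 'X_[m].

Lemma mcoeff_sel f q m : (sel f q)@_m = if f m then q@_m else 0.
Proof.
rewrite /sel raddf_sum /=.
have [mq|mq] := boolP (m \in msupp q).
  rewrite (bigD1_seq m)//= big1_seq => [|m' /andP[m'm _]].
    by rewrite mcoeffZ mcoeffX eqxx mulr1 addr0.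
  by rewrite mcoeffZ mcoeffX (negbTE m'm) mulr0.
rewrite (memN_msupp_eq0 mq) if_same big1_seq// => m' /andP[_ m'q].
rewrite mcoeffZ mcoeffX; case: eqP => [e|_]; last by rewrite mulr0.
by rewrite e (negbTE mq) in m'q.
Qed.

Lemma selD f q q' : sel f (q + q') = sel f q + sel f q'.
Proof.
by apply/mpolyP => m; rewrite mcoeffD !mcoeff_sel mcoeffD; case: ifP; rewrite ?addr0.
Qed.

Lemma sel0 f : sel f 0 = 0.
Proof. by apply/mpolyP => m; rewrite mcoeff_sel mcoeff0 if_same. Qed.

Lemma sel_sum f (J : finType) (P : pred J) (F : J -> Rn) :
  sel f (\sum_(i | P i) F i) = \sum_(i | P i) sel f (F i).
Proof. exact: (big_morph (sel f) (selD f) (sel0 f)). Qed.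

(** Multiplication by a homogeneous [d] shifts the selected degrees. *)
Lemma sel_mul f f' q d :
  (forall m m', d@_m' != 0 -> f (m + m')%MM = f' m) ->
  sel f (q * d) = sel f' q * d.
Proof.
move=> H; apply/mpolyP => m; rewrite mcoeff_sel [RHS]mcoeffM.
have termE m1 m2 : (sel f' q)@_m1 * d@_m2 =
    if f (m1 + m2)%MM then q@_m1 * d@_m2 else 0.
  rewrite mcoeff_sel; have [->|/eqP/H ->] := d@_m2 =P 0; first by rewrite !mulr0 if_same.
  by case: ifP; rewrite ?mul0r.
case: ifPn => fm.
  by rewrite mcoeffM; apply: eq_bigr => k /eqP km; rewrite termE -km fm.
by rewrite big1 // => k /eqP km; rewrite termE -km (negbTE fm).
Qed.

Lemma sel_id f q : (forall m, q@_m != 0 -> f m) -> sel f q = q.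
Proof.
move=> H; apply/mpolyP => m; rewrite mcoeff_sel.
by case: ifPn => // fm; apply/esym/eqP/negPn/(contraNN _ fm); apply: H.
Qed.

(** The part of degree [j - a] of a row vector over generators of degrees [sh];
written with [a] on the other side it is 0 when [j < a]. *)
Definition vproj k (sh : 'I_k -> nat) (a j : nat) (v : 'rV[Rn]_k) : 'rV[Rn]_k :=
  \row_p sel (fun m => mdeg m + a + sh p == j)%N (v 0 p).

Definition graded_mx k' k (sh' : 'I_k' -> nat) (sh : 'I_k -> nat) (D : 'M[Rn]_(k', k)) :=
  forall (p : 'I_k') (q : 'I_k) m, (D p q)@_m != 0 -> (mdeg m + sh q = sh' p)%N.

Lemma vprojM k' k sh' sh (D : 'M[Rn]_(k', k)) a j u : graded_mx sh' sh D ->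
  vproj sh a j (u *m D) = vproj sh' a j u *m D.
Proof.
move=> HD; apply/rowP => q; rewrite !mxE sel_sum; apply: eq_bigr => p _.
rewrite !mxE; apply: sel_mul => m m' /HD e.
by rewrite mdegD -e; congr (_ == _); lia.
Qed.

Definition graded_submodule k (sh : 'I_k -> nat) (M : 'rV[Rn]_k -> Prop) : Prop :=
  [/\ M 0, forall u v, M u -> M v -> M (u + v), forall (c : Rn) v, M v -> M (c *: v)
    & forall a j v, M v -> M (vproj sh a j v)].

Section Submodule.
Context {k : nat} (sh : 'I_k -> nat) (M : 'rV[Rn]_k -> Prop).
Hypothesis MM : graded_submodule sh M.

Lemma submodule_sum (J : Type) (r : seq J) (P : pred J) (F : J -> 'rV_k) :
  (forall i, P i -> M (F i)) -> M (\sum_(i <- r | P i) F i).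
Proof. by case: MM => M0 MD _ _ H; elim/big_ind: _. Qed.

End Submodule.

Section Homogeneous.
Context {k : nat} (sh : 'I_k -> nat).
Implicit Types (z y : {set 'I_n} -> 'rV[Rn]_k).

(** Chains on faces with [i] vertices, of total degree [j], each vertex counting
for 1. *)
Definition homogeneous_chain i j z := forall s p m,
  (z s 0%R p)@_m != 0 -> #|s| = i /\ (mdeg m + i + sh p = j)%N.

Definition chain_proj i j z s : 'rV[Rn]_k :=
  if #|s| == i then vproj sh i j (z s) else 0.

Lemma chain_proj_hom i j z : homogeneous_chain i j (chain_proj i j z).
Proof.
move=> s p m; rewrite /chain_proj; case: (#|s| =P i) => [si|]; last by rewrite mxE mcoeff0 eqxx.
by rewrite mxE mcoeff_sel; case: ifP => [/eqP ->|_]; rewrite ?eqxx.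
Qed.

Lemma chain_proj_id i j z s : homogeneous_chain i j z -> chain_proj i j z s = z s.
Proof.
move=> H; rewrite /chain_proj; case: eqP => [si|si]; apply/rowP => p.
  by rewrite mxE sel_id// => m /H[_ ->].
rewrite mxE; apply/esym/mpolyP => m; rewrite mcoeff0; apply/eqP/negPn/negP.
by move=> /H[].
Qed.

Lemma chain_proj_koszul i j z s :
  koszul (chain_proj i.+1 j z) s = chain_proj i j (koszul z) s.
Proof.
apply/rowP => p; rewrite koszulE /chain_proj.
case: eqP => [si|si]; last first.
  rewrite mxE big1// => l ls; rewrite cardsU1 ls add1n eqSS (introF eqP si).
  by rewrite mxE mulr0.
rewrite mxE koszulE sel_sum; apply: eq_bigr => l ls.
rewrite cardsU1 ls si eqxx mxE mulrC [in RHS]mulrC; apply/esym/sel_mul => m m'.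
rewrite -[_ * 'X_l]mulr1 mcoeff_sgnX; case: ifP => [m'l|]; last by rewrite mulr0 eqxx.
rewrite mcoeff1; have [e|_] := (m' - U_(l))%MM =P 0%MM; last by rewrite mulr0 eqxx.
move=> _; have -> : m' = U_(l)%MM.
  by rewrite -(@submK _ U_(l) m') ?e ?add0m// lep1mP -lt0n.
by rewrite mdegD mdeg1; congr (_ == _); lia.
Qed.

Lemma koszul_hom i j z : homogeneous_chain i.+1 j z -> homogeneous_chain i j (koszul z).
Proof.
move=> H s p m.
rewrite [koszul z s](_ : _ = koszul (chain_proj i.+1 j z) s); last first.
  by apply: eq_kdiff => t; rewrite chain_proj_id.
by rewrite chain_proj_koszul; apply: chain_proj_hom.
Qed.

(** The Koszul homology of [M], which is Tor of [M] and the ground field, is nonzero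
in homological degree [i] and internal degree [j]. *)
Definition koszul_nonvanishing (M : 'rV[Rn]_k -> Prop) i j : Prop := exists z,
  [/\ forall s, M (z s), homogeneous_chain i j z, forall s, koszul z s = 0
    & ~ exists y, (forall s, M (y s)) /\ forall s, koszul y s = z s].

Lemma homogeneous_primitive M i j z y : graded_submodule sh M ->
  homogeneous_chain i j z -> (forall s, M (y s)) -> (forall s, koszul y s = z s) ->
  exists y', [/\ forall s, M (y' s), homogeneous_chain i.+1 j y'
               & forall s, koszul y' s = z s].
Proof.
move=> [M0 _ _ Mp] hz My yz; exists (chain_proj i.+1 j y); split.
- by move=> s; rewrite /chain_proj; case: ifP => // _; apply: Mp.
- exact: chain_proj_hom.
- move=> s; rewrite chain_proj_koszul -(chain_proj_id s hz) /chain_proj yz//.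
Qed.

End Homogeneous.

Section DimensionShift.
Context {k' k : nat} (sh' : 'I_k' -> nat) (sh : 'I_k -> nat) (D : 'M[Rn]_(k', k)).
Context (M : 'rV[Rn]_k -> Prop).
Hypothesis Dgr : graded_mx sh' sh D.
Hypothesis MD : forall v, M v <-> exists u, u *m D = v.
Hypothesis kerm : forall u : 'rV_k', u *m D = 0 -> forall p, (u 0 p)@_0%MM = 0.

Let ker (u : 'rV[Rn]_k') := u *m D = 0.

Lemma koszul_mulmx (w : {set 'I_n} -> 'rV[Rn]_k') s :
  koszul (fun t => w t *m D) s = koszul w s *m D.
Proof.
by rewrite /koszul /kdiff mulmx_suml; apply: eq_bigr => l _; rewrite scalemxAl.
Qed.

Lemma graded_kernel : graded_submodule sh' ker.
Proof.
split=> [|u v|c v|a j v]; rewrite /ker ?mul0mx//.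
- by rewrite mulmxDl => -> ->; rewrite addr0.
- by rewrite -scalemxAl => ->; rewrite scaler0.
- rewrite -(vprojM a j v Dgr) => ->; apply/rowP => p; by rewrite !mxE sel0.
Qed.

Lemma graded_image : graded_submodule sh M.
Proof.
split=> [|u v|c v|a j v].
- by apply/MD; exists 0; rewrite mul0mx.
- by move=> /MD[x <-] /MD[y <-]; apply/MD; exists (x + y); rewrite mulmxDl.
- by move=> /MD[x <-]; apply/MD; exists (c *: x); rewrite scalemxAl.
- by move=> /MD[x <-]; apply/MD; exists (vproj sh' a j x); rewrite -(vprojM a j x Dgr).
Qed.

Lemma hom_mulmx i j w : homogeneous_chain sh' i j w ->
  homogeneous_chain sh i j (fun s => w s *m D).
Proof.
move=> hw s p m.
rewrite [w s *m D](_ : _ = chain_proj sh i j (fun s => w s *m D) s).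
  exact: chain_proj_hom.
rewrite /chain_proj; have := chain_proj_id s hw; rewrite /chain_proj.
case: ifP => _ e; first by rewrite (vprojM _ _ _ Dgr) e.
by rewrite -e mul0mx.
Qed.

Lemma lift_chain z : (forall s, M (z s)) -> exists w, forall s, w s *m D = z s.
Proof.
move=> Mz; have /choice[w wz] : forall s, exists u, u *m D = z s by move=> s; apply/MD.
by exists w.
Qed.

Lemma lift_hom_chain i j z : (forall s, M (z s)) -> homogeneous_chain sh i j z ->
  exists w, homogeneous_chain sh' i j w /\ forall s, w s *m D = z s.
Proof.
move=> Mz hz; have [w wz] := lift_chain Mz; exists (chain_proj sh' i j w).
split; first exact: chain_proj_hom.
move=> s; rewrite -(chain_proj_id s hz) /chain_proj; case: ifP; last by rewrite mul0mx.
by move=> _; rewrite -(vprojM _ _ _ Dgr) wz.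
Qed.

(** The connecting map of 0 -> ker -> F -> M -> 0 in Koszul homology.  It is an
isomorphism because the Koszul complex of F is exact in positive degrees and, in
degree 0, because the kernel lies in the maximal ideal times F. *)
Lemma dimension_shift i j :
  koszul_nonvanishing sh M i.+1 j <-> koszul_nonvanishing sh' ker i j.
Proof.
split=> -[z [zM hz z0 zN]].
- have [w [hw wz]] := lift_hom_chain zM hz.
  have kw s : ker (koszul w s).
    by rewrite /ker -koszul_mulmx -[RHS](z0 s); apply: eq_kdiff => t; rewrite wz.
  exists (koszul w); split=> //; first exact: koszul_hom.
    by move=> s; rewrite /koszul kdiff_sqr.
  move=> [v0 [kv0 v0w]].
  have [v [kv hv vw]] := homogeneous_primitive graded_kernel (koszul_hom hw) kv0 v0w.
  have [s|p|t tE] := @koszul_exact K n k' (fun s => w s - v s).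
  + by rewrite /koszul kdiffB -!/(koszul _) vw subrr.
  + rewrite !mxE mcoeffB.
    have -> : (w finset.set0 0 p)@_0%MM = 0.
      by apply/eqP/negPn/negP => /hw[]; rewrite cards0.
    have -> : (v finset.set0 0 p)@_0%MM = 0; last by rewrite subrr.
    by apply/eqP/negPn/negP => /hv[]; rewrite cards0.
  apply: zN; exists (fun s => t s *m D); split=> s; first by apply/MD; exists (t s).
  by rewrite koszul_mulmx tE mulmxBl wz kv subr0.
- have [y0 y0z] := koszul_exact z0 (fun p => kerm (zM _) p).
  have [||y [_ hy yz]] := homogeneous_primitive (M := fun _ => True) _ hz (y := y0) _ y0z.
    by split.
    by [].
  exists (fun s => y s *m D); split.
  + by move=> s; apply/MD; exists (y s).
  + exact: hom_mulmx.
  + by move=> s; rewrite koszul_mulmx yz; exact: zM.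
  move=> [t [Mt tE]]; have [w wt] := lift_chain Mt.
  apply: zN; exists (fun s => y s - koszul w s); split=> s.
    rewrite /ker mulmxBl -koszul_mulmx -tE; apply/eqP; rewrite subr_eq0; apply/eqP.
    by apply: eq_kdiff => u; rewrite wt.
  by rewrite /koszul kdiffB kdiff_sqr subr0 -/(koszul _) yz.
Qed.

(** Koszul homology in degree 0 is M modulo the maximal ideal times M, for which the
images of the basis of F form a basis by minimality. *)
Lemma koszul0_generators j :
  koszul_nonvanishing sh M 0 j <-> exists p, sh' p = j.
Proof.
split=> [[z [zM hz z0 zN]]|[p pj]].
- apply: contrapT => N.
  have [w [hw wz]] := lift_hom_chain zM hz.
  have [s|p|t tE] := @koszul_exact K n k' w.
  + apply/rowP => p; rewrite mxE; apply/mpolyP => m; rewrite mcoeff0.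
    rewrite koszulE raddf_sum big1// => i is_ /=; rewrite mcoeff_sgnX.
    case: ifP => _; last by rewrite mulr0.
    apply/eqP; rewrite mulf_eq0; apply/orP; right.
    by apply/negPn/negP => /hw[]; rewrite cardsU1 is_.
  + apply/eqP/negPn/negP => /hw[_]; rewrite mdeg0 !add0n => e; apply: N.
    by exists p.
  apply: zN; exists (fun s => t s *m D); split=> s; first by apply/MD; exists (t s).
  by rewrite koszul_mulmx tE wz.
- pose z s := if s == finset.set0 :> {set 'I_n} then row p D else 0.
  have M0 : M 0 by case: graded_image.
  exists z; split.
  + by move=> s; rewrite /z; case: ifP => // _; apply/MD; exists (delta_mx 0 p); rewrite rowE.
  + move=> s q m; rewrite /z; case: (s =P finset.set0) => [->|_]; last by rewrite mxE mcoeff0 eqxx.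
    by rewrite mxE cards0 addn0 => /Dgr ->.
  + move=> s; rewrite /koszul /kdiff big1// => i _; rewrite /z.
    have /negbTE -> : (i |: s)%SET != finset.set0.
      by apply/set0Pn; exists i; rewrite setU11.
    by rewrite scaler0.
  move=> [y [yM yz]]; have [w wy] := lift_chain yM.
  have := yz finset.set0; rewrite /z eqxx => e.
  have /kerm/(_ p) : (delta_mx 0 p - koszul w finset.set0) *m D = 0.
    rewrite mulmxBl -rowE -e -koszul_mulmx; apply/eqP; rewrite subr_eq0; apply/eqP.
    by apply: eq_kdiff => t; rewrite wy.
  rewrite !mxE !eqxx mcoeffB mcoeff1 eqxx -/(koszul w) koszulE raddf_sum big1 => [|i _] /=.
    by rewrite subr0 => /eqP; rewrite oner_eq0.
  by rewrite mcoeff_sgnX mnm0E mulr0.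
Qed.

End DimensionShift.

Section MonomialIdeal.
Context (J : set Rn) (U : 'X_{1..n} -> Prop).
Hypothesis JU : forall q, J q <-> forall m, q@_m != 0 -> U m.

(** The ideal as a submodule of the free module of rank 1. *)
Definition ideal_rows (v : 'rV[Rn]_1) : Prop := J (v 0 0).

Lemma koszul_monomial_ideal i j :
  koszul_nonvanishing (fun=> 0%N) ideal_rows i j <->
  exists2 b, mdeg b = j & @has_homology K n (face U b) i.
Proof.
split=> [[z [zM hz z0 zN]]|[b bj [c [cX c0 cN]]]].
- apply: contrapT => N.
  have [p b|y [yz yU]] := @koszul_assemble K n 1 (fun _ => U) z.
    have cyc s : bd (mgpart p b z) s = 0.
      by rewrite -mgpart_koszul /mgpart z0 mxE mcoeff0 if_same.
    have [bj|bj] := mdeg b =P j.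
      apply: contrapT => N'; apply: N; exists b => //; exists (mgpart p b z); split=> //.
      move=> s; rewrite /mgpart; case: ifPn => [sb ne|]; last by rewrite eqxx.
      split; last by have [] := hz _ _ _ ne.
      by split=> //; apply: (JU _).1 ne; rewrite (ord1 p); exact: zM.
    exists (fun=> 0); split=> s; first by rewrite eqxx.
    rewrite bdE big1 => [|l _]; last by rewrite mulr0.
    rewrite /mgpart; case: ifP => // sb; apply/esym/eqP/negPn/negP => /hz[si].
    rewrite addn0 => e; apply: bj; rewrite -e -si -(mdeg_mset s) -mdegD submK//.
  apply: zN; exists y; split=> // s; apply/JU => m; exact: yU.
- pose z s : 'rV[Rn]_1 := const_mx (c s *: 'X_[b - mset s]).
  have zE p b' s : mgpart p b' z s = if b' == b then c s else 0.
    rewrite /mgpart mxE; have [cs|cs] := c s =P 0.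
      by rewrite cs scale0r mcoeff0 !if_same.
    have [[sb Us] si] := cX s (introN eqP cs).
    rewrite mcoeffZ mcoeffX; case: ifPn => sb'; last first.
      by case: eqP => // e; rewrite e sb in sb'.
    rewrite -(eqm_add2r (mset s)) !submK// eq_sym; case: eqP => _; by rewrite ?mulr1 ?mulr0.
  exists z; split.
  + move=> s; apply/JU => m; rewrite mxE mcoeffZ mcoeffX.
    by case: ((b - mset s)%MM =P m) => [<-|_]; rewrite ?mulr0 ?eqxx// mulr1 => /cX[[]].
  + move=> s p m; rewrite mxE mcoeffZ mcoeffX.
    case: ((b - mset s)%MM =P m) => [<-|_]; rewrite ?mulr0 ?eqxx// mulr1 => /cX[[sb _] si]; split=> //.
    by rewrite addn0 -si -(mdeg_mset s) -mdegD submK.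
  + apply: mgpart_inj => p b' s; rewrite mgpart_koszul.
    rewrite [RHS](_ : _ = 0); last by rewrite /mgpart mxE mcoeff0 if_same.
    rewrite /bd (eq_kdiff _ (zE p b')); case: eqP => _; first exact: c0.
    by rewrite /kdiff big1// => l _; rewrite scaler0.
  move=> [y [yM yz]]; apply: cN; exists (mgpart 0 b y); split=> s.
    rewrite /mgpart; case: ifPn => [sb ne|]; last by rewrite eqxx.
    by split=> //; apply: (JU _).1 ne; exact: yM.
  have := zE 0 b s; rewrite eqxx => <-; rewrite -mgpart_koszul.
  by rewrite /mgpart yz.
Qed.

Lemma graded_ideal_rows : is_ideal J -> graded_submodule (fun=> 0%N) ideal_rows.
Proof.
move=> [J0 JD JM]; split.
- by rewrite /ideal_rows mxE.
- by move=> u v Ju Jv; rewrite /ideal_rows mxE; apply: JD.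
- by move=> c v Jv; rewrite /ideal_rows mxE; apply: JM.
- move=> a j v Jv; rewrite /ideal_rows mxE; apply/JU => m; rewrite mcoeff_sel.
  by case: ifP => _; [move/JU: Jv; apply|rewrite eqxx].
Qed.

End MonomialIdeal.
End GradedModules.
(** * Minimal generators of graded submodules *)
Section FiniteSpan.
Local Open Scope nat_scope.

(** A finite family from [S] with the span of largest dimension spans all of [S]. *)
Lemma finite_span (F : fieldType) (d : nat) (T : choiceType) (phi : T -> 'rV[F]_d)
    (S : T -> Prop) : exists t : seq T,
  (forall x, x \in t -> S x) /\ forall x, S x -> (phi x \in <<map phi t>>)%VS.
Proof.
pose P k := `[< exists2 t : seq T, (forall x, x \in t -> S x) & \dim <<map phi t>> = k >].
have P0 : exists k, P k.
  by exists (\dim <<map phi [::]>>); apply/asboolP; exists [::].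
have Pb k : P k -> k <= d.
  by move=> /asboolP[t _ <-]; rewrite (leq_trans (dimvS (subvf _)))// dimvf /dim /= mul1n.
case: (ex_maxnP P0 Pb) => k /asboolP[t tS tk] kmax; exists t; split=> // x Sx.
have /kmax : P (\dim <<map phi (x :: t)>>).
  apply/asboolP; exists (x :: t) => // y; rewrite inE => /orP[/eqP ->//|]; exact: tS.
rewrite -tk /= span_cons => le.
have sub : (<<map phi t>> <= <[phi x]> + <<map phi t>>)%VS by apply: addvSr.
have := dimv_leqif_sup sub => -[le' /esym].
rewrite eqn_leq le' le => /subvP; apply.
by apply: (subvP (addvSl _ _)); exact: memv_line.
Qed.

End FiniteSpan.

Section MinimalGenerators.
Context {K : fieldType} {n : nat}.
Local Notation Rn := {mpoly K[n]}.

Section Generators.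
Context {k : nat} (sh : 'I_k -> nat) (M : 'rV[Rn]_k -> Prop).
Hypothesis MM : graded_submodule sh M.

Definition homogeneous_row j (v : 'rV[Rn]_k) :=
  forall p m, (v 0 p)@_m != 0 -> (mdeg m + sh p = j)%N.

Lemma homogeneous_vproj j v : homogeneous_row j (vproj sh 0 j v).
Proof.
by move=> p m; rewrite mxE mcoeff_sel addn0; case: ifP => [/eqP|_]; rewrite ?eqxx.
Qed.

Lemma vproj_sum (v : 'rV[Rn]_k) : exists B, v = \sum_(j < B) vproj sh 0 j v.
Proof.
exists (\sum_p (msize (v 0%R p) + sh p)).+1%N; apply/rowP => p; rewrite summxE.
apply/mpolyP => m; rewrite raddf_sum /=.
have [e0|/eqP ne] := (v 0 p)@_m =P 0.
  by rewrite e0 big1// => j _; rewrite mxE mcoeff_sel e0 if_same.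
have lt : (mdeg m + sh p < (\sum_p (msize (v 0%R p) + sh p)).+1)%N.
  rewrite ltnS (bigD1 p)//= (leq_trans _ (leq_addr _ _))// leq_add2r.
  by apply/ltnW/msize_mdeg_lt; rewrite mcoeff_msupp.
rewrite (bigD1 (Ordinal lt))//= mxE mcoeff_sel addn0 eqxx big1 ?addr0// => j jn.
rewrite mxE mcoeff_sel addn0; case: eqP => // e; case/eqP: jn; exact: val_inj.
Qed.

(** Rows of degree [j] are determined by finitely many coefficients, because their
monomials have degree at most [j]. *)
Lemma degree_span j : exists t : seq 'rV[Rn]_k,
  (forall v, v \in t -> M v /\ homogeneous_row j v) /\
  forall v, M v -> homogeneous_row j v ->
    exists c : 'I_(size t) -> K, v = \sum_(i < size t) (c i)%:MP *: t`_i.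
Proof.
pose I : finType := ('I_k * 'X_{1..n < j.+1})%type.
pose phi (v : 'rV[Rn]_k) : 'rV[K]_#|{: I}| :=
  \row_i (fun x : I => (v 0 x.1)@_x.2) (enum_val i).
have [t [tS tspan]] := finite_span phi (fun v => M v /\ homogeneous_row j v).
exists t; split=> // v Mv hv.
have := tspan v (conj Mv hv); rewrite -[map phi t]/(tval (in_tuple (map phi t))).
move/coord_span; set X := in_tuple _ => vE.
have sX : size (map phi t) = size t by rewrite size_map.
exists (fun i => coord X (cast_ord (esym sX) i) (phi v)).
apply/rowP => p; apply/mpolyP => m; rewrite summxE raddf_sum /=.
have [mj|mj] := ltnP (mdeg m) j.+1; last first.
  have zero u : homogeneous_row j u -> (u 0 p)@_m = 0.
    move=> hu; apply/eqP/negPn/negP => /hu e; move: mj; rewrite -e.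
    by rewrite ltnNge leq_addr.
  rewrite zero// big1// => i _; rewrite mxE mcoeffCM zero ?mulr0//.
  by have [] := tS _ (mem_nth 0 (ltn_ord i)).
pose x : I := (p, BMultinom mj).
have coefE (u : 'rV[Rn]_k) : (u 0 p)@_m = phi u 0 (enum_rank x) by rewrite mxE enum_rankK.
rewrite coefE {1}vE summxE (reindex (cast_ord (esym sX))) /=; last first.
  by exists (cast_ord sX) => i _; apply: val_inj.
apply: eq_bigr => i _; rewrite !mxE mcoeffCM; congr (_ * _).
rewrite [X`_ _](_ : _ = phi t`_i); last by rewrite /= (nth_map 0).
by rewrite mxE enum_rankK.
Qed.

(** Nakayama in one degree: vanishing of Koszul homology in degree (0, j) means that
elements of degree [j] are combinations of elements of degree [j - 1]. *)
Lemma homogeneous_in_maximal j v : ~ koszul_nonvanishing sh M 0 j ->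
  M v -> homogeneous_row j v ->
  exists w : 'I_n -> 'rV[Rn]_k, (forall i, M (w i) /\
    forall p m, (w i 0 p)@_m != 0 -> (mdeg m + 1 + sh p = j)%N) /\
    exists c : 'I_n -> Rn, v = \sum_i c i *: w i.
Proof.
move=> NK Mv hv; have [M0 _ _ _] := MM.
pose z (s : {set 'I_n}) : 'rV[Rn]_k := if s == finset.set0 then v else 0.
have zM s : M (z s) by rewrite /z; case: ifP.
have hz : homogeneous_chain sh 0 j z.
  move=> s p m; rewrite /z; case: (s =P finset.set0) => [->|_].
    by move=> /hv; rewrite cards0 addn0.
  by rewrite mxE mcoeff0 eqxx.
have z0 s : koszul z s = 0.
  rewrite /koszul /kdiff big1// => i _; rewrite /z.
  have /negbTE -> : (i |: s)%SET != finset.set0.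
    by apply/set0Pn; exists i; rewrite setU11.
  by rewrite scaler0.
have [y [yM yz]] : exists y, (forall s, M (y s)) /\ forall s, koszul y s = z s.
  by apply: contrapT => N; apply: NK; exists z.
have [y' [yM' hy yz']] := homogeneous_primitive MM hz yM yz.
exists (fun i => y' (i |: finset.set0)%SET); split.
  by move=> i; split=> // p m /hy[].
exists (fun i => ksgn i finset.set0 * 'X_i).
have := yz' finset.set0; rewrite /z eqxx => <-.
by apply: eq_bigl => i; rewrite inE.
Qed.

(** Bases of the degrees up to [N] generate: above [N] every homogeneous
element of [M] is a combination of elements of [M] of smaller degree. *)
Lemma graded_generators N : (forall j, (N < j)%N -> ~ koszul_nonvanishing sh M 0 j) ->
  exists k' (sh' : 'I_k' -> nat) (D : 'M[Rn]_(k', k)),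
    graded_mx sh' sh D /\ forall v, M v <-> exists u, u *m D = v.
Proof.
move=> HN; have [M0 MD MZ Mp] := MM.
have /choice[T HT] := degree_span.
pose L := [seq (j, v) | j <- iota 0 N.+1, v <- T j].
have LP x : x \in L -> M x.2 /\ homogeneous_row x.1 x.2.
  by move=> /allpairsPdep[j [v [_ /(HT j).1 vT ->]]].
pose D : 'M[Rn]_(size L, k) := \matrix_(i, q) (nth (0%N, 0) L i).2 0 q.
have rowD i : row i D = (nth (0%N, 0) L i).2 by apply/rowP => q; rewrite !mxE.
exists (size L), (fun i => (nth (0%N, 0) L i).1), D; split.
  by move=> i q m; rewrite mxE => /(LP _ (mem_nth _ (ltn_ord i))).2.
pose Im (v : 'rV[Rn]_k) := exists u : 'rV[Rn]_(size L), u *m D = v.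
have ImD u v : Im u -> Im v -> Im (u + v).
  by move=> [x <-] [y <-]; exists (x + y); rewrite mulmxDl.
have ImZ c v : Im v -> Im (c *: v).
  by move=> [x <-]; exists (c *: x); rewrite scalemxAl.
have Im_sum (J : Type) (r : seq J) (F : J -> 'rV[Rn]_k) :
    (forall i, Im (F i)) -> Im (\sum_(i <- r) F i).
  by move=> H; elim/big_ind: _ => //; exists 0; rewrite mul0mx.
have ImL x : x \in L -> Im x.2.
  move=> xL; have i_lt : (index x L < size L)%N by rewrite index_mem.
  by exists (delta_mx 0 (Ordinal i_lt)); rewrite -rowE rowD /= nth_index.
have Imh j v : M v -> homogeneous_row j v -> Im v.
  elim/ltn_ind: j v => j IHj v Mv hv; have [jN|Nj] := leqP j N.
    have [c ->] := (HT j).2 v Mv hv; apply: Im_sum => i; apply: ImZ.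
    apply: (ImL (j, (T j)`_i)); apply/allpairsPdep; exists j, (T j)`_i; split=> //.
    - by rewrite mem_iota.
    - exact: mem_nth.
  have [w [wM [c ->]]] := homogeneous_in_maximal (HN j Nj) Mv hv.
  apply: Im_sum => i; apply: ImZ; have [Mw hw] := wM i.
  apply: (IHj j.-1); [by case: (j) Nj|by []|].
  by move=> p m /hw <-; rewrite addn1 addSn.
move=> v; split=> [Mv|[u <-]].
  have [B ->] := vproj_sum v; apply: Im_sum => j.
  by apply: (Imh j); [exact: Mp|exact: homogeneous_vproj].
rewrite mulmx_sum_row; apply: (submodule_sum MM) => i _; apply: MZ.
by rewrite rowD; have [] := LP _ (mem_nth (0%N, 0) (ltn_ord i)).
Qed.

(** Take as few generators as possible.  A relation with a nonzero constant
coefficient has, in the degree of the corresponding generator, a homogeneous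
part that expresses this generator by the others. *)
Lemma minimal_graded_generators N : (forall j, (N < j)%N -> ~ koszul_nonvanishing sh M 0 j) ->
  exists k' (sh' : 'I_k' -> nat) (D : 'M[Rn]_(k', k)),
    [/\ graded_mx sh' sh D, forall v, M v <-> exists u, u *m D = v
      & forall u : 'rV_k', u *m D = 0 -> forall p, (u 0 p)@_0%MM = 0].
Proof.
move=> HN.
pose P k' := `[< exists (sh' : 'I_k' -> nat) (D : 'M[Rn]_(k', k)),
    graded_mx sh' sh D /\ forall v, M v <-> exists u, u *m D = v >].
have P0 : exists k', P k'.
  by have [k' H] := graded_generators HN; exists k'; apply/asboolP.
case: (ex_minnP P0) => k' /asboolP[sh' [D [Dgr MD]]] kmin.
exists k', sh', D; split=> // u uD p; apply/eqP/negPn/negP.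
case: k' => [|k'] in sh' D Dgr MD kmin u uD p *; first by case: p.
move=> up; pose u' := vproj sh' 0 (sh' p) u.
have u'D : u' *m D = 0.
  by rewrite -(vprojM _ _ _ Dgr) uD; apply/rowP => q; rewrite !mxE sel0.
set c := (u 0 p)@_0%MM in up.
have u'p : u' 0 p = c%:MP.
  apply/mpolyP => m; rewrite mxE mcoeff_sel addn0 -[X in (_ == X)]add0n eqn_add2r.
  rewrite mdeg_eq0 mcoeffC; case: eqP => [->|_]; by rewrite ?mulr1 ?mulr0.
have /kmin : P k'; last by rewrite ltnn.
apply/asboolP; exists (fun i => sh' (lift p i)), (row' p D); split.
  by move=> i q m; rewrite mxE; exact: Dgr.
move=> v; rewrite MD; split=> [[x <-]|[x <-]].
- pose x' := x - (x 0 p * (c^-1)%:MP) *: u'.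
  exists (col' p x'); have <- : x' *m D = x *m D.
    by rewrite mulmxBl -scalemxAl u'D scaler0 subr0.
  have x'p : x' 0 p = 0.
    have -> : x' 0 p = x 0 p - (x 0 p * (c^-1)%:MP) * u' 0 p by rewrite !mxE.
    by rewrite u'p -mulrA -mpolyCM mulVf// mpolyC1 mulr1 subrr.
  apply/rowP => q; rewrite !mxE (bigD1_ord p)//= x'p mul0r add0r.
  by apply: eq_bigr => i _; rewrite !mxE.
- exists (\row_i (if unlift p i is Some j then x 0 j else 0)).
  apply/rowP => q; rewrite !mxE (bigD1_ord p)//= mxE unlift_none mul0r add0r.
  by apply: eq_bigr => i _; rewrite !mxE liftK.
Qed.

End Generators.
End MinimalGenerators.
(** * Minimal resolutions, Betti numbers and regularity *)
Section Resolutions.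
Context {K : fieldType} {n : nat}.
Local Notation Rn := {mpoly K[n]}.

Section Existence.

Record graded_state := GradedState {
  st_rk : nat;
  st_sh : 'I_st_rk -> nat;
  st_mod : 'rV[Rn]_st_rk -> Prop }.

(** The finiteness that replaces the noetherian property: it passes from a module to
its syzygies by dimension shift, and provides finitely many generators. *)
Definition koszul_finite (S : graded_state) : Prop :=
  graded_submodule (@st_sh S) (@st_mod S) /\
  forall i, exists N, forall j, (N < j)%N -> ~ koszul_nonvanishing (@st_sh S) (@st_mod S) i j.

Definition cover (S : graded_state) : Type :=
  {k : nat & (('I_k -> nat) * 'M[Rn]_(k, st_rk S))%type}.

Definition minimal_cover (S : graded_state) (T : cover S) : Prop :=
  [/\ graded_mx (tagged T).1 (@st_sh S) (tagged T).2,
      forall v, st_mod v <-> exists u, u *m (tagged T).2 = v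
    & forall u : 'rV_(tag T), u *m (tagged T).2 = 0 -> forall p, (u 0 p)@_0%MM = 0].

(** Stated for all states, with the hypothesis inside, so that covers can be chosen
by a function. *)
Lemma minimal_cover_exists S : exists T : cover S, koszul_finite S -> minimal_cover T.
Proof.
have [[gr fin]|nS] := pselect (koszul_finite S); last first.
  by exists (existT _ 0%N (fun=> 0%N, 0)).
have [N HN] := fin 0%N; have [k' [sh' [D H]]] := minimal_graded_generators gr HN.
by exists (existT _ k' (sh', D)).
Qed.

Definition choose_cover S : cover S := projT1 (cid (minimal_cover_exists S)).

Lemma choose_coverP S : koszul_finite S -> minimal_cover (choose_cover S).
Proof. by rewrite /choose_cover; case: cid. Qed.

Definition syzygy (S : graded_state) : graded_state :=
  GradedState (tagged (choose_cover S)).1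
    (fun u : 'rV[Rn]_(tag (choose_cover S)) => u *m (tagged (choose_cover S)).2 = 0).

Lemma syzygy_koszul_finite S : koszul_finite S -> koszul_finite (syzygy S).
Proof.
move=> Sf; have [gr img kerm] := choose_coverP Sf; split.
  exact: graded_kernel gr.
move=> i; have [N HN] := Sf.2 i.+1; exists N => j /HN nK H; apply: nK.
exact/(dimension_shift gr img kerm).
Qed.

Definition syz (S : graded_state) i := iter i syzygy S.

Variable J : set Rn.
Let S0 := @GradedState 1 (fun=> 0%N) (ideal_rows J).

Definition syzygy_resolution : @free_complex K n :=
  @FreeComplex K n (fun i => st_rk (syz S0 i.+1)) (fun i => @st_sh (syz S0 i.+1))
    (tagged (choose_cover S0)).2 (fun i => (tagged (choose_cover (syz S0 i.+1))).2).

Lemma syzygy_resolutionP : koszul_finite S0 ->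
  minimal_graded_free_resolution J syzygy_resolution.
Proof.
move=> Sf.
have Sfi i : koszul_finite (syz S0 i).
  by elim: i => //= i; exact: syzygy_koszul_finite.
have C i := choose_coverP (Sfi i).
split.
- split=> [p|i p q].
    have [gr _ _] := C 0%N; apply/dhomogP => m; rewrite mcoeff_msupp => /gr.
    by rewrite addn0.
  have [gr _ _] := C i.+1.
  have [e|/eqP] := dif syzygy_resolution i p q =P 0; first by left.
  rewrite -msupp_eq0; case E: (msupp _) => [//|m r] _; right.
  have mE : (mdeg m + sh q = sh p)%N.
    have : m \in msupp (dif syzygy_resolution i p q) by rewrite E inE eqxx.
    by rewrite mcoeff_msupp; exact: gr.
  exists (mdeg m); first by rewrite addnC.
  apply/dhomogP => m'; rewrite mcoeff_msupp => /gr; rewrite -[X in _ = X]mE.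
  by move/eqP; rewrite eqn_add2r => /eqP.
- split=> [f|u|i u].
  + have [_ img _] := C 0%N; have := img (const_mx f).
    rewrite /= /ideal_rows mxE => ->; split=> -[u H]; exists u; first by rewrite H mxE.
    by apply/rowP => p; rewrite (ord1 p) [RHS]mxE; exact: H.
  + have [_ img _] := C 1%N; have := img u; rewrite /= => ->.
    by split=> -[v H]; exists v.
  + have [_ img _] := C i.+2; have := img u; rewrite /= => ->.
    by split=> -[v H]; exists v.
- move=> i p q; have [_ _ kerm] := C i.
  have [_ img _] := C i.+1.
  have /kerm/(_ q) : st_mod (row p (dif syzygy_resolution i)).
    by apply/img; exists (delta_mx 0 p); rewrite rowE.
  by rewrite mxE.
Qed.

End Existence.

Section Betti.
Variables (J : set Rn) (F : @free_complex K n).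
Hypothesis HF : minimal_graded_free_resolution J F.

Let Fgr : graded_mx (@sh _ _ F 0) (fun=> 0%N) (aug F).
Proof.
have [[H _] _ _] := HF; move=> p q m; rewrite (ord1 q) -mcoeff_msupp addn0.
by move/dhomogP: (H p); apply.
Qed.

Let dgr i : graded_mx (@sh _ _ F i.+1) (@sh _ _ F i) (dif F i).
Proof.
have [[_ H] _ _] := HF; move=> p q m ne.
case: (H i p q) => [e|[k -> /dhomogP hk]]; first by rewrite e mcoeff0 eqxx in ne.
by rewrite addnC hk// mcoeff_msupp.
Qed.

Let image_const0 i (u : 'rV[Rn]_(rk F i)) (v : 'rV[Rn]_(rk F i.+1)) p :
  u = v *m dif F i -> (u 0 p)@_0%MM = 0.
Proof.
move=> ->; have [_ _ Fmin] := HF; rewrite mxE raddf_sum big1// => q _ /=.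
by rewrite rmorphM /= Fmin mulr0.
Qed.

Let augker (u : 'rV[Rn]_(rk F 0)) : u *m aug F = 0 -> forall p, (u 0 p)@_0%MM = 0.
Proof. by have [_ [_ H _] _] := HF; move=> /H[v /image_const0]. Qed.

Let difker i (u : 'rV[Rn]_(rk F i.+1)) : u *m dif F i = 0 -> forall p, (u 0 p)@_0%MM = 0.
Proof. by have [_ [_ _ H] _] := HF; move=> /H[v /image_const0]. Qed.

Let augimg v : ideal_rows J v <-> exists u, u *m aug F = v.
Proof.
have [_ [H _ _] _] := HF; rewrite /ideal_rows H; split=> -[u uv]; exists u.
  by apply/rowP => p; rewrite (ord1 p).
by rewrite uv.
Qed.

(** The kernel of the map leaving F_i, which is the (i+1)-st syzygy module. *)
Let cycles i : 'rV[Rn]_(rk F i) -> Prop :=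
  match i with
  | 0 => fun u => u *m aug F = 0
  | i'.+1 => fun u => u *m dif F i' = 0
  end.

Let cycles_img i v : cycles v <-> exists u, u *m dif F i = v.
Proof.
case: i v => [|i] v; have [_ [_ H1 H2] _] := HF; rewrite /= ?H1 ?H2;
  by split=> -[u e]; exists u.
Qed.

Lemma koszul_cycles i s j :
  koszul_nonvanishing (@sh _ _ F i) (@cycles i) s j <->
  koszul_nonvanishing (fun=> 0%N) (ideal_rows J) (s + i.+1) j.
Proof.
elim: i s => [|i IHi] s.
  by rewrite addn1 (dimension_shift Fgr augimg augker).
by rewrite -(dimension_shift (@dgr i) (@cycles_img i) (@difker i)) IHi addSnnS.
Qed.

(** The generators of F_i are the minimal generators of the i-th syzygy module, and
shifting dimensions i times brings the count back to the ideal. *)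
Lemma betti_koszul i j : betti F i j != 0%N <->
  koszul_nonvanishing (fun=> 0%N) (ideal_rows J) i j.
Proof.
rewrite -lt0n /betti; have -> : (0 < #|[set p : 'I_(rk F i) | sh p == j]%SET|)%N <->
    exists p : 'I_(rk F i), sh p = j.
  split=> [/card_gt0P[p]|[p e]]; first by rewrite inE => /eqP; exists p.
  by apply/card_gt0P; exists p; rewrite inE e.
case: i => [|i]; first by rewrite (koszul0_generators Fgr augimg augker).
have := koszul_cycles i 0 j; rewrite add0n => <-.
by rewrite (koszul0_generators (@dgr i) (@cycles_img i) (@difker i)).
Qed.

End Betti.

Lemma nat_max_le (A : set nat) B : (forall r, A r -> r <= B)%N -> (nat_max A <= B)%N.
Proof.
move=> AB; rewrite /nat_max; case: xgetP => [k _ [Ak _]|_]//; exact: AB.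
Qed.

Lemma nat_max_ge (A : set nat) B r : (forall r, A r -> r <= B)%N -> A r ->
  (r <= nat_max A)%N.
Proof.
move=> AB Ar; rewrite /nat_max; case: xgetP => [k _ [_ H]|N]; first exact: H.
have E : exists k, `[< A k >] by exists r; apply/asboolP.
case: (@ex_maxnP (fun k => `[< A k >]) B E) => [k /asboolP/AB//|k /asboolP Ak kmax].
by exfalso; apply: (N k); split=> // l Al; apply: kmax; apply/asboolP.
Qed.

Section Regularity.
Variables (J : set Rn) (U : 'X_{1..n} -> Prop).
Hypothesis J_ideal : is_ideal J.
Hypothesis JU : forall q, J q <-> forall m, q@_m != 0 -> U m.

Lemma regularity_le B : (forall i b, @has_homology K n (face U b) i -> mdeg b <= i + B)%N ->
  (regularity J <= B)%N.
Proof.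
move=> H; apply: nat_max_le => r [F HF [i]].
rewrite (betti_koszul HF) (koszul_monomial_ideal JU) => -[b e /H].
by rewrite e leq_add2l.
Qed.

(** The first bound makes the maximum in the definition of the regularity exist; the
second makes the Koszul homology of the ideal bounded, hence yields a minimal
resolution. *)
Lemma regularity_ge B D i b r :
  (forall i b, @has_homology K n (face U b) i -> mdeg b <= i + B)%N ->
  (forall i b, @has_homology K n (face U b) i -> mdeg b <= D)%N ->
  @has_homology K n (face U b) i -> mdeg b = (i + r)%N ->
  (r <= regularity J)%N.
Proof.
move=> HB HD Hb e; apply: (@nat_max_ge _ B).
  move=> r' [F HF [i']].
  rewrite (betti_koszul HF) (koszul_monomial_ideal JU) => -[b' e' /HB].
  by rewrite e' leq_add2l.
have HF : minimal_graded_free_resolution J (syzygy_resolution J).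
  apply: syzygy_resolutionP; split; first exact: graded_ideal_rows JU J_ideal.
  move=> i'; exists D => j Dj /(koszul_monomial_ideal JU)[b' b'j /HD].
  by rewrite b'j leqNgt Dj.
exists (syzygy_resolution J) => //; exists i.
by rewrite (betti_koszul HF) (koszul_monomial_ideal JU); exists b.
Qed.

End Regularity.
End Resolutions.
(** * Higman's lemma *)
Section Higman.
Local Open Scope nat_scope.
Implicit Types (u v s : seq nat).

(** The Higman order on words: [u] is dominated letter by letter by a subword of
[v].  For exponent words this is divisibility of [v] by an Inc-translate of [u]. *)
Definition emb u v : Prop := exists2 v', subseq v' v & all2 leq u v'.

Lemma emb_nil v : emb [::] v.
Proof. by exists [::] => //; exact: sub0seq. Qed.

Lemma emb_behead u v : emb u (behead v) -> emb u v.
Proof.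
by move=> [v' sv uv]; exists v' => //; apply: subseq_trans sv _;
  case: (v) => // a w; exact: subseq_cons.
Qed.

Lemma emb_cons a u b v : a <= b -> emb u v -> emb (a :: u) (b :: v).
Proof. by move=> ab [v' sv uv]; exists (b :: v'); rewrite /= ?eqxx ?ab. Qed.

Lemma emb_count w u v : all (fun a => a <= w) u ->
  size u <= count (fun a => w <= a) v -> emb u v.
Proof.
move=> uw; rewrite -size_filter; set f := seq.filter _ _ => uf.
exists (take (size u) f).
  exact: subseq_trans (take_subseq _ _) (filter_subseq _ _).
have : all (fun a => w <= a) f by exact: filter_all.
elim: u f uw uf => [|a u IHu] [|b f] //= /andP[aw uw] uf /andP[wb wf].
by rewrite (leq_trans aw wb) /=; apply: IHu.
Qed.

Lemma nondecreasing_subsequence (a : nat -> nat) : exists phi : nat -> nat,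
  (forall i j, i < j -> phi i < phi j) /\ (forall i j, i <= j -> a (phi i) <= a (phi j)).
Proof.
have /choice[m Hm] : forall N, exists k, N <= k /\ forall l, N <= l -> a k <= a l.
  move=> N; pose P x := `[< exists2 k, N <= k & a k = x >].
  have P0 : exists x, P x by exists (a N); apply/asboolP; exists N.
  case: (ex_minnP P0) => x /asboolP[k Nk <-] kmin; exists k; split=> // l Nl.
  by apply: kmin; apply/asboolP; exists l.
pose phi := fix phi i := if i is i'.+1 then m (phi i').+1 else m 0.
have phiS i : phi i < phi i.+1 by have [] := Hm (phi i).+1.
have phi_mono i j : i < j -> phi i < phi j.
  by elim: j => // j IHj; rewrite ltnS leq_eqVlt => /orP[/eqP->//|/IHj/ltn_trans]; apply.
have aS i : a (phi i) <= a (phi i.+1).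
  case: i => [|i]; first by apply: (Hm 0).2.
  by apply: (Hm (phi i).+1).2; apply: ltn_trans (phiS i) (phiS i.+1).
exists phi; split=> // i j; elim: j => [|j IHj]; first by rewrite leqn0 => /eqP ->.
by rewrite leq_eqVlt => /orP[/eqP->//|/IHj/leq_trans]; apply.
Qed.

Definition bad (f : nat -> seq nat) := forall i j, i < j -> ~ emb (f i) (f j).

(** Choose successively a bad continuation of the word sequence built so far whose
next word is as short as possible; the diagonal sequence is bad because each of
its initial parts extends to a bad sequence. *)
Lemma minimal_bad f0 : bad f0 -> exists2 g, bad g &
  forall n h, bad h -> (forall i, i < n -> h i = g i) -> size (g n) <= size (h n).
Proof.
move=> bf0.
have /choice[step Hstep] : forall nf : nat * (nat -> seq nat), exists g, bad nf.2 ->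
    [/\ bad g, forall i, i < nf.1 -> g i = nf.2 i & forall h, bad h ->
      (forall i, i < nf.1 -> h i = nf.2 i) -> size (g nf.1) <= size (h nf.1)].
  move=> [n f] /=; have [bf|nbf] := pselect (bad f); last by exists f.
  pose P x := `[< exists g, [/\ bad g, forall i, i < n -> g i = f i & size (g n) = x] >].
  have P0 : exists x, P x by exists (size (f n)); apply/asboolP; exists f.
  case: (ex_minnP P0) => x /asboolP[g [bg gf gx]] xmin; exists g => _; split=> // h bh hf.
  by rewrite gx; apply: xmin; apply/asboolP; exists h.
pose F := fix F n := if n is n'.+1 then step (n, F n') else step (0, f0).
have bF n : bad (F n).
  by elim: n => [|n IHn] /=; [have [] := Hstep (0, f0) bf0|have [] := Hstep (n.+1, F n) IHn].
have FS n i : i <= n -> F n.+1 i = F n i.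
  by move=> i_n; have [_ + _] := Hstep (n.+1, F n) (bF n); apply.
have FE n i : i <= n -> F n i = F i i.
  elim: n => [|n IHn]; first by rewrite leqn0 => /eqP ->.
  by rewrite leq_eqVlt => /orP[/eqP->//|i_n]; rewrite FS// IHn.
exists (fun n => F n n) => [i j ij|].
  by rewrite -(FE j i (ltnW ij)); exact: bF.
case=> [|n] h bh hg.
  by have [_ _] := Hstep (0, f0) bf0; apply.
have [_ _] := Hstep (n.+1, F n) (bF n); apply=> // i i_n.
by rewrite hg//= -(FE n i).
Qed.

(** Nash-Williams' argument: in a minimal bad sequence, pass to indices with
nondecreasing first letters and delete these letters; the result, glued to the
earlier words, is a bad sequence smaller than the minimal one. *)
Lemma higman f : exists i j, i < j /\ emb (f i) (f j).
Proof.
apply: contrapT => N.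
have [g bg gmin] : exists2 g, bad g &
    forall n h, bad h -> (forall i, i < n -> h i = g i) -> size (g n) <= size (h n).
  by apply: (minimal_bad (f0 := f)) => i j ij e; apply: N; exists i, j.
have gE n : g n = head 0 (g n) :: behead (g n).
  case E : (g n) => [|//]; case: (bg n n.+1 (ltnSn n)); rewrite E; exact: emb_nil.
have [phi [phi_lt phi_le]] := nondecreasing_subsequence (fun n => head 0 (g n)).
pose h i := if i < phi 0 then g i else behead (g (phi (i - phi 0))).
have : size (g (phi 0)) <= size (h (phi 0)).
  apply: gmin => [i j ij|i lt]; last by rewrite /h lt.
  rewrite /h; case: (ltnP i (phi 0)) => i0; case: (ltnP j (phi 0)) => j0.
  - exact: bg.
  - move/emb_behead; apply: bg; apply: leq_trans i0 _.
    have [->//|] := posnP (j - phi 0); by move=> /phi_lt/ltnW.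
  - by move: (leq_ltn_trans i0 (ltn_trans ij j0)); rewrite ltnn.
  - have lt : i - phi 0 < j - phi 0 by rewrite ltn_sub2r// (leq_ltn_trans i0).
    move=> e; apply: (bg _ _ (phi_lt _ _ lt)).
    rewrite gE (gE (phi (j - _))); apply: emb_cons e.
    exact/phi_le/ltnW.
by rewrite /h ltnn subnn {1}gE /= ltnn.
Qed.

(** Otherwise words of [S] avoiding all earlier ones could be picked forever. *)
Lemma finite_basis (S : seq nat -> Prop) : exists B : seq (seq nat),
  (forall b, b \in B -> S b) /\ forall s, S s -> exists2 b, b \in B & emb b s.
Proof.
apply: contrapT => N.
have /choice[p Hp] : forall B : seq (seq nat), exists s, (forall b, b \in B -> S b) ->
    S s /\ forall b, b \in B -> ~ emb b s.
  move=> B; have [BS|nBS] := pselect (forall b, b \in B -> S b); last by exists [::].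
  apply: contrapT => N'; apply: N; exists B; split=> // s Ss.
  apply: contrapT => N''; apply: N'; exists s => _; split=> // b bB e.
  by apply: N''; exists b.
pose L := fix L n := if n is n'.+1 then p (L n') :: L n' else [::].
have LS n : forall b, b \in L n -> S b.
  elim: n => [//|n IHn] b; rewrite inE => /orP[/eqP ->|]; last exact: IHn.
  by have [] := Hp _ IHn.
have [i [j [ij]]] := higman (fun n => p (L n)).
apply: (Hp _ (LS j)).2.
elim: j ij => // j IHj; rewrite ltnS leq_eqVlt inE => /orP[/eqP ->|/IHj ->].
  by rewrite eqxx.
by rewrite orbT.
Qed.

Lemma subseq_delete s v : subseq s v -> size s < size v ->
  exists x1 y x2, v = x1 ++ y :: x2 /\ subseq s (x1 ++ x2).
Proof.
elim: v s => [|b v IHv] [|a s] //=.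
  by exists [::], b, v; split=> //; exact: sub0seq.
case: eqP => [->|_] sv; last by exists [::], b, v.
rewrite ltnS => /(IHv _ sv)[x1 [y [x2 [-> sx]]]].
by exists (b :: x1), y, x2; rewrite /= eqxx.
Qed.

End Higman.
(** * Monomial ideals and the action of increasing maps *)
Section MonomialIdeals.
Context {K : fieldType} {n : nat}.
Local Notation Rn := {mpoly K[n]}.
Implicit Types (J S : set Rn) (G : set 'X_{1..n}) (m u v : 'X_{1..n}).

Lemma ideal_gen_is_ideal S : is_ideal (ideal_gen S).
Proof.
split.
- by move=> A [[A0 _ _] _].
- by move=> f g Hf Hg A HA; have [[_ AD _] _] := HA; apply: AD; [apply: Hf|apply: Hg].
- by move=> f g Hg A HA; have [[_ _ AM] _] := HA; apply: AM; apply: Hg.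
Qed.

Lemma is_ideal_sum J (T : eqType) (r : seq T) (F : T -> Rn) : is_ideal J ->
  (forall i, i \in r -> J (F i)) -> J (\sum_(i <- r) F i).
Proof.
by move=> [J0 JD _] H; rewrite big_seq; elim/big_ind: _.
Qed.

Lemma is_ideal_scale J (c : K) f : is_ideal J -> J f -> J (c *: f).
Proof. by move=> [_ _ JM] Jf; rewrite -mul_mpolyC; apply: JM. Qed.

Lemma is_ideal_mpolyX_le J m m' : is_ideal J -> J 'X_[m] -> (m <= m')%MM -> J 'X_[m'].
Proof.
by move=> [_ _ JM] Jm mm'; rewrite -(submK mm') mpolyXD; apply: JM.
Qed.

Lemma is_ideal_supp J f : is_ideal J -> (forall m, f@_m != 0 -> J 'X_[m]) -> J f.
Proof.
move=> HJ H; rewrite [f]mpolyE; apply: is_ideal_sum => // m mf.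
by apply: is_ideal_scale => //; apply: H; rewrite -mcoeff_msupp.
Qed.

Lemma supp_is_ideal (P : 'X_{1..n} -> Prop) : upclosed P ->
  is_ideal [set f : Rn | forall m, f@_m != 0 -> P m].
Proof.
move=> Pup; split => [m|f g Hf Hg m|f g Hg m] /=.
- by rewrite mcoeff0 eqxx.
- rewrite mcoeffD; have [->|/eqP/Hf//] := f@_m =P 0.
  by rewrite add0r; exact: Hg.
- rewrite -mcoeff_msupp => /msuppM_le/allpairsP[[m1 m2] /= [_ m2g ->]].
  by apply: Pup (Hg m2 _) (lem_addl _ _); rewrite -mcoeff_msupp.
Qed.

Lemma monomial_genP G (f : Rn) :
  monomial_gen G f <-> forall m, f@_m != 0 -> exists2 g, G g & (g <= m)%MM.
Proof.
split=> [|H]; last first.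
  apply: is_ideal_supp; first exact: ideal_gen_is_ideal.
  move=> m /H[g Gg]; apply: is_ideal_mpolyX_le; first exact: ideal_gen_is_ideal.
  by apply: sub_gen_smallest; exists g.
have id : is_ideal [set f : Rn | forall m, f@_m != 0 -> exists2 g, G g & (g <= m)%MM].
  by apply: supp_is_ideal => m m' [g Gg gm] mm'; exists g => //; apply: lepm_trans mm'.
apply: (smallest_sub id) => _ [g Gg <-] m.
rewrite mcoeffX; case: (g =P m) => [<-|]; rewrite ?eqxx// => _.
by exists g => //; exact: lepm_refl.
Qed.

(** A monomial ideal is determined by the monomials it contains; this is the form in
which the hypothesis on the ideals is used. *)
Lemma monomial_idealP J : is_ideal J -> is_monomial_ideal J ->
  forall f, J f <-> forall m, f@_m != 0 -> J 'X_[m].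
Proof.
move=> HJ [G JG] f; split; last exact: is_ideal_supp.
rewrite JG => /monomial_genP H m /H[g Gg gm]; apply/monomial_genP => m'.
rewrite mcoeffX; case: (m =P m') => [<-|]; rewrite ?eqxx// => _; by exists g.
Qed.

Lemma monomial_genX G u : monomial_gen G ('X_[u] : Rn) <-> exists2 g, G g & (g <= u)%MM.
Proof.
rewrite monomial_genP; split=> [/(_ u)|H m]; first by apply; rewrite mcoeffX eqxx oner_eq0.
by rewrite mcoeffX; case: (u =P m) => [<-|]; rewrite ?eqxx.
Qed.

(** The monomials of [J] minimal under divisibility; they belong to every set of
monomials that generates [J]. *)
Lemma minimal_generating_set_exists J : is_ideal J -> is_monomial_ideal J ->
  exists G, is_minimal_generating_set J G.
Proof.
move=> HJ Jm; pose G : set 'X_{1..n} :=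
  [set u | J 'X_[u] /\ forall v, J 'X_[v] -> (v <= u)%MM -> v = u].
have below u : J 'X_[u] -> exists2 g, G g & (g <= u)%MM.
  move: {-1}(mdeg u) (leqnn (mdeg u)) => d; elim: d u => [|d IHd] u ud Ju.
    exists u; last exact: lepm_refl.
    split=> // v Jv vu; apply/mnmP => i; apply/eqP; rewrite eqn_leq (mnm_lepP vu)/=.
    move: ud; rewrite leqn0 mdeg_eq0 => /eqP ->; by rewrite mnm0E.
  have [Gu|nGu] := pselect (G u); first by exists u => //; exact: lepm_refl.
  have [v [Jv vu vNu]] : exists v, [/\ J 'X_[v], (v <= u)%MM & v <> u].
    by apply: contrapT => N; apply: nGu; split=> // v Jv vu;
      apply: contrapT => ?; apply: N; exists v.
  have [|g Gg gv] := IHd v _ Jv; last by exists g => //; apply: lepm_trans gv vu.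
  rewrite -ltnS (leq_trans _ ud)// -(submK vu) mdegD -[X in (X < _)%N]add0n ltn_add2r lt0n.
  rewrite mdeg_eq0; apply/eqP => e; apply: vNu.
  by rewrite -(submK vu) e add0m.
exists G; split.
  apply/seteqP; split=> f.
    move=> /(monomial_idealP HJ Jm) H; apply/monomial_genP => m /H; exact: below.
  move/monomial_genP => H; apply/(monomial_idealP HJ Jm) => m /H[g [Jg _]].
  exact: is_ideal_mpolyX_le.
move=> G' sub JG'; apply/seteqP; split=> // g Gg.
have : J 'X_[g] by case: Gg.
rewrite JG' => /monomial_genX[g' Gg' g'g].
have [_ /(_ g') H] := Gg; rewrite -H//.
by have [] := sub _ Gg'.
Qed.

Lemma nat_minP (A : set nat) : (exists a, A a) ->
  A (nat_min A) /\ forall l, A l -> (nat_min A <= l)%N.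
Proof.
move=> [a Aa]; rewrite /nat_min; case: xgetP => [k _ []//|N].
have E : exists k, `[< A k >] by exists a; apply/asboolP.
case: (ex_minnP E) => k /asboolP Ak kmin; exfalso; apply: (N k); split=> // l Al.
by apply: kmin; apply/asboolP.
Qed.

Lemma weight_le u v : (u <= v)%MM -> (weight u <= weight v)%N.
Proof.
move=> uv; apply/bigmax_leqP => i _; apply: leq_trans (mnm_lepP uv i) _.
exact: leq_bigmax.
Qed.

(** Passing to a multiple does not lower the weight, so the weight of [J] is a
minimum over all monomials of [J]. *)
Lemma ideal_weightP J u0 : is_ideal J -> is_monomial_ideal J -> J 'X_[u0] ->
  (exists2 u, J 'X_[u] & weight u = ideal_weight J) /\
  forall u, J 'X_[u] -> (ideal_weight J <= weight u)%N.
Proof.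
move=> HJ Jm Ju0.
have [JG _] : is_minimal_generating_set J (min_gens J).
  rewrite /min_gens; case: xgetP => // N.
  by have [G HG] := minimal_generating_set_exists HJ Jm; case: (N G).
have JE u : J 'X_[u] <-> exists2 g, min_gens J g & (g <= u)%MM.
  by rewrite -monomial_genX -JG.
have [|[g Gg gw] wmin] := @nat_minP [set weight u | u in min_gens J].
  by have /JE[g Gg _] := Ju0; exists (weight g), g.
split; first by exists g => //; apply/JE; exists g => //; exact: lepm_refl.
move=> u /JE[h Gh hu]; apply: leq_trans (weight_le hu).
by apply: wmin; exists h.
Qed.

End MonomialIdeals.

Section IncAction.
Context {K : fieldType}.

Lemma Inc_mn_lt m n pi i : Inc_mn m n pi -> (i < m)%N -> (pi i < n)%N.
Proof.
move=> [pi_inc pim] im; apply: leq_ltn_trans pim.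
have : (i <= m.-1)%N by case: (m) im.
by rewrite leq_eqVlt => /orP[/eqP ->//|/pi_inc/ltnW].
Qed.

Lemma inc_actE m n pi (f : {mpoly K[m]}) :
  inc_act n pi f = \sum_(u <- msupp f) f@_u *: inc_act n pi 'X_[u].
Proof. exact: comp_mpolyEX. Qed.

Lemma inc_actX m n pi (u : 'X_{1..m}) (Hpi : forall i, (i < m)%N -> (pi i < n)%N) :
  inc_act n pi ('X_[u] : {mpoly K[m]}) =
  \prod_(i < m) 'X_(Ordinal (Hpi i (ltn_ord i))) ^+ u i.
Proof.
rewrite /inc_act comp_mpolyX; apply: eq_bigr => i _; rewrite tnth_mktuple.
by rewrite (insubT (fun x => x < n)%N (Hpi i (ltn_ord i))).
Qed.

Lemma inc_act_comp m n n' pi rho (f : {mpoly K[m]}) :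
  (forall i, (i < m)%N -> (pi i < n)%N) ->
  inc_act n' rho (inc_act n pi f) = inc_act n' (rho \o pi) f.
Proof.
move=> Hpi; rewrite (inc_actE n pi) (inc_actE _ (rho \o pi)).
rewrite {1}/inc_act linear_sum /=; apply: eq_bigr => u _.
rewrite linearZ; congr (_ *: _); rewrite (inc_actX _ Hpi) /inc_act.
rewrite rmorph_prod /= comp_mpolyX. apply: eq_bigr => i _.
by rewrite rmorphXn /= comp_mpolyXU -tnth_nth !tnth_mktuple.
Qed.

Lemma inc_act_id m (f : {mpoly K[m]}) : inc_act m id f = f.
Proof.
rewrite -[RHS]comp_mpoly_id /inc_act; congr (_ \mPo _); apply: eq_from_tnth => i.
by rewrite !tnth_mktuple valK.
Qed.

(** An increasing map moves exponents without lowering any of them. *)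
Lemma inc_act_weight m n pi (f : {mpoly K[m]}) w : Inc_mn m n pi ->
  (forall v, f@_v != 0 -> (w <= weight v)%N) ->
  forall v, (inc_act n pi f)@_v != 0 -> (w <= weight v)%N.
Proof.
move=> Hpi Hf v; have Hlt i : (i < m)%N -> (pi i < n)%N := Inc_mn_lt Hpi.
have [//|vw] := leqP w (weight v).
case/eqP; rewrite inc_actE raddf_sum big1_seq// => u /andP[_ uf] /=.
rewrite mcoeffZ (inc_actX _ Hlt).
rewrite mprodXnE mcoeffX; case: eqP => [e|_]; last by rewrite mulr0.
have uw : (w <= weight u)%N by apply: Hf; rewrite -mcoeff_msupp.
exfalso; suff : (weight u <= weight v)%N by rewrite leqNgt (leq_trans vw uw).
apply/bigmax_leqP => i _.
apply: leq_trans (leq_bigmax (Ordinal (Hlt i (ltn_ord i)))).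
rewrite -e mnm_sumE (bigD1 i)//= mulmnE mnm1E eqxx mul1n leq_addr//.
Qed.

End IncAction.
(** * Invariant chains of monomial ideals *)
Section Chain.
Context {K : fieldType} (I : forall n : nat, set {mpoly K[n]}).
Arguments I : clear implicits.
Hypothesis I_ideal : forall n, (1 <= n)%N -> is_ideal (I n).
Hypothesis I_monomial : forall n, (1 <= n)%N -> is_monomial_ideal (I n).
Hypothesis I_proper : forall n, (1 <= n)%N -> I n <> setT.
Hypothesis I_invariant : Inc_invariant I.
Hypothesis I_nonzero : chain_nonzero I.
Implicit Types s t u v : seq nat.

(** Exponents are also written as words of natural numbers, which makes monomials in
different numbers of variables comparable. *)
Definition mnm_of n s : 'X_{1..n} := [multinom nth 0%N s i | i < n].
Definition word n (m : 'X_{1..n}) : seq nat := [seq m i | i <- enum 'I_n].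

Lemma size_word n (m : 'X_{1..n}) : size (word m) = n.
Proof. by rewrite size_map size_enum_ord. Qed.

Lemma nth_word n (m : 'X_{1..n}) (i : 'I_n) : nth 0%N (word m) i = m i.
Proof. by rewrite (nth_map i) ?size_enum_ord// nth_ord_enum. Qed.

Lemma wordK n (m : 'X_{1..n}) : mnm_of n (word m) = m.
Proof. by apply/mnmP => i; rewrite mnmE nth_word. Qed.

Lemma count_word n (m : 'X_{1..n}) (P : pred nat) :
  count P (word m) = #|[set i | P (m i)]%SET|.
Proof.
rewrite cardE /word count_map -size_filter enumT; congr (size _).
by rewrite /enum_mem; apply: eq_filter => i; rewrite !inE.
Qed.

Definition in_chain s := (0 < size s)%N /\ I (size s) 'X_[mnm_of (size s) s].

Lemma in_chainE n s : size s = n -> in_chain s <-> (0 < n)%N /\ I n 'X_[mnm_of n s].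
Proof. by move=> <-. Qed.

Lemma in_chain_word n (m : 'X_{1..n}) : (0 < n)%N -> in_chain (word m) <-> I n 'X_[m].
Proof.
move=> n0; rewrite (in_chainE (size_word m)) wordK; by split=> [[]|].
Qed.

Lemma in_chain_le s t : size s = size t ->
  (forall i, (nth 0 s i <= nth 0 t i)%N) -> in_chain s -> in_chain t.
Proof.
move=> e st; rewrite (in_chainE e) => -[t0 It]; split=> //.
apply: is_ideal_mpolyX_le It _; first exact: I_ideal.
by apply/mnm_lepP => i; rewrite !mnmE.
Qed.

(** The increasing map that skips one value inserts a letter 0. *)
Lemma inc_act_insert n x1 x2 : size (x1 ++ x2) = n ->
  inc_act n.+1 (bump (size x1)) ('X_[mnm_of n (x1 ++ x2)] : {mpoly K[n]}) =
  'X_[mnm_of n.+1 (x1 ++ 0%N :: x2)].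
Proof.
move=> sn.
have Hlt i : (i < n)%N -> (bump (size x1) i < n.+1)%N.
  by move=> lt; rewrite /bump; lia.
have jn : (size x1 < n.+1)%N by rewrite -sn size_cat ltnS leq_addr.
rewrite (inc_actX _ Hlt) [RHS]mpolyXE_id (bigD1_ord (Ordinal jn))//= mnmE /=.
rewrite nth_cat ltnn subnn expr0 mul1r; apply: eq_bigr => i _.
rewrite (_ : Ordinal _ = lift (Ordinal jn) i); last exact: val_inj.
congr (_ ^+ _); rewrite !mnmE /= !nth_cat /bump.
have [le|lt] := leqP (size x1) i; last by rewrite lt.
by rewrite add1n ltnNge (leq_trans le (leqnSn _)) subSn.
Qed.

Lemma bump_Inc_mn n j : (0 < n)%N -> Inc_mn n n.+1 (bump j).
Proof.
move=> n0; split; first by move=> i k ik; rewrite /bump; lia.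
by rewrite /bump; lia.
Qed.

Lemma in_chain_insert x1 y x2 : in_chain (x1 ++ x2) -> in_chain (x1 ++ y :: x2).
Proof.
move=> H; apply: (@in_chain_le (x1 ++ 0%N :: x2)).
- by rewrite !size_cat.
- by move=> i; rewrite !nth_cat; case: ifP => // _; case: (_ - _)%N.
move En : (size (x1 ++ x2)) => n; move: H; rewrite (in_chainE En) => -[n0 In].
have s1 : size (x1 ++ 0%N :: x2) = n.+1 by rewrite -En !size_cat /= addnS.
rewrite (in_chainE s1); split=> //; rewrite -(inc_act_insert En).
apply: (I_invariant (m := n)); first by rewrite n0 leqnSn.
apply: sub_gen_smallest; exists (bump (size x1)); first exact: bump_Inc_mn.
by exists 'X_[mnm_of n (x1 ++ x2)].
Qed.

(** Inserting letters one at a time, only the increasing maps that skip a single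
value are needed. *)
Lemma in_chain_subseq s v : subseq s v -> in_chain s -> in_chain v.
Proof.
move En : (size v) => n; elim: n v En => [|n IHn] v sv sub Hs.
  by move/size0nil: sv sub => ->; rewrite subseq0 => /eqP <-.
have := size_subseq sub; rewrite leq_eqVlt => /orP[e|lt].
  by have := (size_subseq_leqif sub).2; rewrite e => /esym/eqP <-.
have [x1 [y [x2 [vE sx]]]] := subseq_delete sub lt.
rewrite vE; apply: in_chain_insert; apply: IHn => //.
by move: sv; rewrite vE !size_cat /= addnS => -[].
Qed.

Lemma in_chain_emb s v : emb s v -> in_chain s -> in_chain v.
Proof.
move=> [v' sv sv'] Hs; apply: in_chain_subseq sv _; apply: in_chain_le Hs.
  by move: sv'; rewrite all2E => /andP[/eqP].
move=> i; elim: s v' sv' i => [|a s IHs] [|b v'] //= /andP[ab sv] [|i] //=.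
exact: IHs.
Qed.

Lemma in_chain_basis : exists B : seq (seq nat),
  (forall b, b \in B -> in_chain b) /\
  forall s, in_chain s -> exists2 b, b \in B & emb b s.
Proof. exact: finite_basis. Qed.

(** Every word is above one of finitely many basis words.  Once it is longer than all
of these, some letter is not used by the embedding and can be deleted. *)
Lemma in_chain_delete : exists r, forall n s, (r <= n)%N -> size s = n.+1 -> in_chain s ->
  exists x1 y x2, s = x1 ++ y :: x2 /\ in_chain (x1 ++ x2).
Proof.
have [B [BI HB]] := in_chain_basis.
exists (\max_(b <- B) size b) => n s rn sn /HB[b bB [v' sv bv]].
have sb : size b = size v' by move: bv; rewrite all2E => /andP[/eqP].
have lt : (size v' < size s)%N.
  by rewrite sn ltnS -sb (leq_trans _ rn)// (leq_bigmax_seq b).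
have [x1 [y [x2 [sE sub]]]] := subseq_delete sv lt.
exists x1, y, x2; split=> //; apply: in_chain_emb (BI b bB); by exists v'.
Qed.

(** Deleting letters one at a time leads from [I n] down to [I m]; the increasing
maps that put them back are composed. *)
Lemma stable_exists : exists r, stable_from I r.
Proof.
have [r Hr] := in_chain_delete; exists r.+1; split=> // m n /andP[rm mn].
have m0 : (0 < m)%N by apply: leq_trans rm.
apply/seteqP; split; first by apply: I_invariant; rewrite m0.
rewrite -(subnKC mn); elim: (n - m)%N => [|d IHd].
  rewrite addn0 => f If; apply: sub_gen_smallest.
  exists id; first by split => //; rewrite prednK.
  by exists f => //; rewrite inc_act_id.
rewrite addnS; set N := (m + d)%N in IHd *.
have N0 : (0 < N)%N by rewrite addn_gt0 m0.
move=> f; move/(monomial_idealP (I_ideal (ltn0Sn N)) (I_monomial (ltn0Sn N))) => If.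
apply: is_ideal_supp; first exact: ideal_gen_is_ideal.
move=> v /If /(in_chain_word v (ltn0Sn N)).
have rN : (r <= N)%N by rewrite (leq_trans (ltnW rm))// leq_addr.
move=> /(Hr N _ rN (size_word v))[x1 [y [x2 [vE Hx]]]].
have sx : size (x1 ++ x2) = N.
  by have := size_word v; rewrite vE !size_cat /= addnS => -[].
have le : (mnm_of N.+1 (x1 ++ 0%N :: x2) <= v)%MM.
  rewrite -[v]wordK vE; apply/mnm_lepP => i; rewrite !mnmE !nth_cat.
  by case: ifP => // _; case: (_ - _)%N.
apply: is_ideal_mpolyX_le le; first exact: ideal_gen_is_ideal.
rewrite -(inc_act_insert sx).
have /IHd : I N 'X_[mnm_of N (x1 ++ x2)] by move: Hx; rewrite (in_chainE sx) => -[].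
have [G0 GD GM] := ideal_gen_is_ideal (@inc_image K m N.+1 (I m)).
have Pid : is_ideal [set g : {mpoly K[N]} |
    ideal_gen (@inc_image K m N.+1 (I m)) (inc_act N.+1 (bump (size x1)) g)].
  split=> [|f1 f2 H1 H2|f1 f2 H2] /=.
  - by rewrite /inc_act comp_mpoly0.
  - by rewrite /inc_act comp_mpolyD; apply: GD.
  - by rewrite /inc_act rmorphM; apply: GM.
apply: (smallest_sub Pid) => _ [pi Hpi [g Ig ->]] /=.
rewrite inc_act_comp; last by move=> i; apply: Inc_mn_lt.
apply: sub_gen_smallest; exists (bump (size x1) \o pi); last by exists g.
have [b_inc b_lt] := bump_Inc_mn (size x1) N0; have [pi_inc pi_lt] := Hpi.
split=> [i k ik|] /=; first by apply: b_inc; apply: pi_inc.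
by move: pi_lt; rewrite /bump; lia.
Qed.

Let r0 := stability_index I.
Let w := chain_weight I.

Lemma stability_indexP : stable_from I r0.
Proof. by have [] := nat_minP stable_exists. Qed.

Lemma r0_gt0 : (0 < r0)%N. Proof. by have [] := stability_indexP. Qed.

Lemma in_chain_nseq0 s n : in_chain s -> in_chain (s ++ nseq n 0%N).
Proof. by apply: in_chain_subseq; exact: prefix_subseq. Qed.

(** If [I r0] vanished, stability would make all later ideals vanish, while a nonzero
ideal of the chain yields nonzero ideals in all later degrees. *)
Lemma in_chain_r0 : exists u : 'X_{1..r0}, I r0 'X_[u].
Proof.
have [n [n0 [f If /negP f0]]] := I_nonzero.
have [m mf] : exists m, f@_m != 0.
  apply: contrapT => N; apply: f0; apply/eqP/mpolyP => m; rewrite mcoeff0.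
  by apply/eqP/negPn/negP => H; apply: N; exists m.
have Im : I n 'X_[m] by move/(monomial_idealP (I_ideal n0) (I_monomial n0)): If; apply.
move/(in_chain_word m n0)/(in_chain_nseq0 r0): Im.
have : size (word m ++ nseq r0 0%N) = (n + r0)%N by rewrite size_cat size_word size_nseq.
set N := (n + r0)%N => sN; rewrite (in_chainE sN) => -[N0 IN].
apply: contrapT => H.
have I0 g : I r0 g -> g = 0.
  move=> /(monomial_idealP (I_ideal r0_gt0) (I_monomial r0_gt0)) Ig.
  apply/mpolyP => k; rewrite mcoeff0; apply/eqP/negPn/negP => /Ig Ik.
  by apply: H; exists k.
move: IN; have [_ /(_ r0 N) <-] := stability_indexP; last by rewrite leqnn leq_addl.
have Zid : is_ideal [set g : {mpoly K[N]} | g = 0].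
  by split=> [|f1 f2 /= -> ->|f1 f2 /= ->]; rewrite /= ?addr0 ?mulr0.
move=> H0; have := smallest_sub Zid _ H0; move=> /(_ _)/wrap[].
  by move=> _ [pi _ [g /I0 -> ->]] /=; rewrite /inc_act comp_mpoly0.
move/mpolyP/(_ (mnm_of N (word m ++ nseq r0 0%N))).
by rewrite mcoeffX eqxx mcoeff0 => /eqP; rewrite oner_eq0.
Qed.

Lemma all_word n (m : 'X_{1..n}) a : (weight m <= a)%N -> all (fun b => b <= a)%N (word m).
Proof.
move=> ma; apply/allP => b /mapP[i _ ->]; exact: leq_trans (leq_bigmax i) ma.
Qed.

Lemma chain_weight_attained : exists2 u, in_chain u & all (fun a => a <= w)%N u.
Proof.
have [u0 Iu0] := in_chain_r0.
have [[u Iu uw] _] := ideal_weightP (I_ideal r0_gt0) (I_monomial r0_gt0) Iu0.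
exists (word u); first exact/in_chain_word/Iu/r0_gt0.
by apply: all_word; rewrite uw.
Qed.

Lemma chain_weight_gt0 : (0 < w)%N.
Proof.
rewrite lt0n; apply/eqP => w0; have [u Iu uw] := chain_weight_attained.
move: Iu; move En : (size u) => n; rewrite (in_chainE En) => -[n0].
rewrite (_ : mnm_of n u = 0%MM); last first.
  apply/mnmP => i; rewrite mnmE mnm0E.
  by move/allP: uw => /(_ (nth 0%N u i) (mem_nth _ _));
    rewrite w0 leqn0 En ltn_ord => /(_ isT)/eqP.
rewrite mpolyX0 => I1; apply: (I_proper n0); apply/seteqP; split=> // f _.
by have [_ _ IM] := I_ideal n0; rewrite -[f]mulr1; apply: IM.
Qed.

(** Padded with zeros, the word lies in an ideal generated by translates of [I r0],
and translates and multiples do not lower the weight. *)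
Lemma chain_weight_le s : in_chain s -> has (fun a => w <= a)%N s.
Proof.
move=> /(in_chain_nseq0 r0).
have : size (s ++ nseq r0 0%N) = (size s + r0)%N by rewrite size_cat size_nseq.
set N := (size s + r0)%N => sN; rewrite (in_chainE sN) => -[N0].
have [_ /(_ r0 N) <-] := stability_indexP; last by rewrite leqnn leq_addl.
have Wid : is_ideal [set g : {mpoly K[N]} | forall m, g@_m != 0 -> (w <= weight m)%N].
  by apply: supp_is_ideal => m m' wm mm'; apply: leq_trans wm (weight_le mm').
have [u0 Iu0] := in_chain_r0.
have [_ wmin] := ideal_weightP (I_ideal r0_gt0) (I_monomial r0_gt0) Iu0.
move=> H; have {H} := smallest_sub Wid _ H; move=> /(_ _)/wrap[].
  move=> _ [pi Hpi [g Ig ->]] /=; apply: inc_act_weight Hpi _ => v gv.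
  apply: wmin; move/(monomial_idealP (I_ideal r0_gt0) (I_monomial r0_gt0)): Ig; exact.
move/(_ (mnm_of N (s ++ nseq r0 0%N))); rewrite mcoeffX eqxx oner_eq0 => /(_ isT) wle.
have [i iw] : exists i : 'I_N, (w <= nth 0 (s ++ nseq r0 0%N) i)%N.
  apply: contrapT => H; move: wle; rewrite leqNgt => /negP; apply.
  rewrite -(prednK chain_weight_gt0) ltnS; apply/bigmax_leqP => i _; rewrite mnmE.
  by rewrite -ltnS prednK ?chain_weight_gt0// ltnNge; apply/negP => ?; apply: H; exists i.
move: iw; rewrite nth_cat; case: ltnP => [lt iw|_].
  by apply/hasP; exists (nth 0%N s i) => //; exact: mem_nth.
by rewrite nth_nseq if_same leqNgt chain_weight_gt0.
Qed.

(** [D] is the largest letter in a finite basis: letters above [D] can be cut down to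
[D] without leaving the chain. *)
Lemma chain_letters_bounded : exists D, forall n (m : 'X_{1..n}) k,
  I n 'X_[m] -> (D < m k)%N -> I n 'X_[m - U_(k)].
Proof.
have [B [BI HB]] := in_chain_basis.
exists (\max_(b <- B) \max_(a <- b) a); set D := \max_(b <- B) _ => n m k Im Dk.
have n0 : (0 < n)%N by case: (n) k {m Im Dk} => // -[].
apply/(in_chain_word _ n0).
have /HB[b bB [v' sv bv]] : in_chain (word m) by apply/in_chain_word.
have Hmin : in_chain [seq minn D a | a <- word m].
  apply: in_chain_emb (BI b bB); exists [seq minn D a | a <- v'].
    exact: map_subseq.
  have : all (fun a => a <= D)%N b.
    apply/allP => a ab; apply: (@leq_trans (\max_(a <- b) a)).
      by rewrite (leq_bigmax_seq a).
    by rewrite (leq_bigmax_seq b).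
  elim: b v' bv {bB sv} => [|a b IHb] [|a' v'] //= /andP[aa' bv] /andP[aD bD].
  by rewrite leq_min aD aa' /=; apply: IHb.
apply: in_chain_le Hmin; first by rewrite size_map !size_word.
move=> i; have [ni|ni] := leqP n i.
  by rewrite nth_default// size_map size_word.
rewrite (nth_map 0%N) ?size_word// (nth_word m (Ordinal ni)) (nth_word _ (Ordinal ni)).
rewrite mnmBE mnm1E; case: eqP => [<-|_]; last by rewrite subn0 geq_minr.
by rewrite subn1 geq_min -ltnS prednK ?Dk// (leq_trans _ Dk).
Qed.

Lemma chain_upclosed n : (0 < n)%N -> upclosed (fun m => I n 'X_[m]).
Proof. by move=> n0 m m'; apply: is_ideal_mpolyX_le; exact: I_ideal. Qed.

Lemma chain_large_exponents u : in_chain u -> all (fun a => a <= w)%N u ->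
  forall n (m : 'X_{1..n}) (A : {set 'I_n}), (size u <= #|A|)%N ->
  (forall k, k \in A -> w <= m k)%N -> I n 'X_[m].
Proof.
move=> Hu uw n m A uA Aw.
have n0 : (0 < n)%N.
  have [u0 _] := Hu; apply: leq_trans u0 (leq_trans uA _).
  by rewrite -[X in (_ <= X)%N]card_ord max_card.
apply/(in_chain_word _ n0); apply: in_chain_emb (Hu).
apply: (emb_count uw); rewrite count_word (leq_trans uA)// subset_leq_card//.
by apply/fintype.subsetP => k /Aw; rewrite inE.
Qed.

Lemma chain_homology_bounds : exists C D, forall n, (0 < n)%N -> forall i b,
  @has_homology K n (face (fun m => I n 'X_[m]) b) i ->
  (mdeg b <= i + (w.-1 * n + C))%N /\ (mdeg b <= n * D)%N.
Proof.
have [u Hu uw] := chain_weight_attained; have [D HD] := chain_letters_bounded.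
exists (size u + size u * D)%N, D => n n0 i b Hb.
have [le bD] := koszul_homology_upper chain_weight_gt0
  (@chain_large_exponents u Hu uw n) (@HD n) Hb.
split; first by rewrite addnA.
have : (\sum_(k < n) b k <= \sum_(k < n) D)%N by apply: leq_sum => k _.
by rewrite sum_nat_const card_ord mdegE.
Qed.

Lemma regularity_upper : exists C, forall n, (0 < n)%N ->
  (regularity (I n) <= w.-1 * n + C)%N.
Proof.
have [C [D H]] := chain_homology_bounds; exists C => n n0.
apply: (regularity_le (monomial_idealP (I_ideal n0) (I_monomial n0))) => i b.
by move=> /(H n n0)[].
Qed.

(** A word with letters at most [w] and as few letters [w] as possible: replacing one
of these by any number of letters [w - 1] leaves the chain. *)
Lemma chain_extremal_word : exists a c, [/\ in_chain (a ++ w :: c),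
    all (fun x => x <= w)%N (a ++ w :: c)
  & forall l, ~ in_chain (a ++ nseq l w.-1 ++ c)].
Proof.
pose P q := `[< exists u, [/\ in_chain u, all (fun x => x <= w)%N u & count_mem w u = q] >].
have P0 : exists q, P q.
  by have [u Hu uw] := chain_weight_attained; exists (count_mem w u); apply/asboolP; exists u.
case: (ex_minnP P0) => q /asboolP[u [Hu uw uq]] qmin.
have wu : w \in u.
  have /hasP[x xu wx] := chain_weight_le Hu.
  have xw : (x <= w)%N by move/allP: uw; apply.
  by rewrite (_ : w = x)//; apply/eqP; rewrite eqn_leq wx.
case/splitPr: wu Hu uw uq => a c Hu uw uq; exists a, c; split=> // l Hl.
have ww : (w.-1 == w) = false by apply/eqP; have := chain_weight_gt0; lia.
have /qmin : P (count_mem w (a ++ nseq l w.-1 ++ c)).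
  apply/asboolP; exists (a ++ nseq l w.-1 ++ c); split=> //.
  move: uw; rewrite !all_cat /= => /and3P[-> _ ->].
  by rewrite all_nseq leq_pred orbT.
rewrite -uq !count_cat count_nseq /= ww mul0n eqxx; lia.
Qed.

(** The multidegree is [a ++ nseq L w ++ c], and [M] is the set of the [L] middle
positions. *)
Lemma regularity_lower : exists C N, forall n, (N <= n)%N ->
  (w.-1 * n <= regularity (I n) + C)%N.
Proof.
have [a [c [Hu uw Nl]]] := chain_extremal_word.
have [C [D HCD]] := chain_homology_bounds.
set p := size a; set e := (size a + size c)%N.
exists (w.-1 * e)%N, e.+1 => n en.
have n0 : (0 < n)%N by apply: leq_trans en.
pose L := (n - e)%N; have L0 : (0 < L)%N by rewrite subn_gt0.
have nE : n = (p + L + size c)%N by rewrite /L /e /p; lia.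
have shift_lt (i : 'I_L) : (p + i < n)%N by have := ltn_ord i; lia.
pose M : {set 'I_n} := [set Ordinal (shift_lt i) | i : 'I_L]%SET.
have MP (k : 'I_n) : (k \in M) = (p <= k < p + L)%N.
  apply/imsetP/andP => [[i _ ->]|[pk kL]]; first by rewrite /= leq_addr ltn_add2l.
  have lt : (k - p < L)%N by lia.
  by exists (Ordinal lt) => //; apply: val_inj; rewrite /= subnKC.
have cM : #|M| = L.
  by rewrite card_imset ?card_ord// => i j [/addnI/val_inj].
pose b := mnm_of n (a ++ nseq L w ++ c).
have nthE (x : nat) (y z : seq nat) : size z = L ->
    nth 0%N (a ++ z ++ y) x = if (x < p)%N then nth 0%N a x else
      if (x < p + L)%N then nth 0%N z (x - p) else nth 0%N y (x - p - L).
  by move=> zL; rewrite !nth_cat zL -/p; case: ltnP => // px; rewrite ltn_subLR.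
have bM k : k \in M -> b k = w.
  rewrite MP => /andP[pk kL]; rewrite mnmE nthE ?size_nseq// ltnNge pk kL /= nth_nseq.
  by rewrite ltn_subLR// kL.
have M0 : M != finset.set0 by rewrite -card_gt0 cM.
have [|||||b' b'M Hb'] := @koszul_homology_lower K n (fun m => I n 'X_[m]) b M.
- exact: chain_upclosed.
- by [].
- by move=> k /bM ->; exact: chain_weight_gt0.
- move=> k kM; have := kM; rewrite MP => /andP[pk kL].
  (* The extremal word, with its letter [w] at position [k] and zeros elsewhere in M. *)
  pose z := nseq (k - p) 0%N ++ w :: nseq (p + L - k.+1) 0%N.
  have sz : size z = L by rewrite size_cat /= !size_nseq; lia.
  have Hz : in_chain (a ++ z ++ c).
    apply: in_chain_subseq Hu; rewrite /z -catA cat_cons.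
    apply: cat_subseq => //; apply: subseq_trans (suffix_subseq _ _).
    by rewrite /= eqxx suffix_subseq.
  have sn : size (a ++ z ++ c) = n by rewrite (size_cat a) (size_cat z) sz -/p addnA.
  move: Hz; rewrite (in_chainE sn) => -[_ Iz]; apply: (chain_upclosed n0 Iz).
  apply/mnm_lepP => i; rewrite mnmBE !mnmE !nthE ?size_nseq// !inE MP.
  case: ltnP => [ip|pi]; first by rewrite andbF subn0.
  case: ltnP => [iL|]; last by rewrite !andbF subn0.
  rewrite !nth_nseq /= ltn_subLR// iL /z nth_cat size_nseq /= andbT.
  case: ltnP => ik; first by rewrite nth_nseq if_same.
  have [->|ki] := eqVneq i k; first by rewrite subnn subn0.
  have : (0 < i - p - (k - p))%N.
    by rewrite -subnDA subnKC// subn_gt0 ltn_neqAle eq_sym -(inj_eq val_inj) /= in ki *; lia.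
  by case: (i - p - (k - p))%N => //= j _; rewrite nth_nseq if_same.
- have sn : size (a ++ nseq L w.-1 ++ c) = n by rewrite !size_cat size_nseq -/p addnA.
  move=> H; apply: (Nl L); apply/(in_chainE sn); split=> //.
  move: H; rewrite (_ : (b - mset M)%MM = mnm_of n (a ++ nseq L w.-1 ++ c))//.
  apply/mnmP => i; rewrite mnmBE !mnmE !nthE ?size_nseq// MP.
  case: ltnP => [ip|pi]; first by rewrite subn0.
  case: ltnP => [iL|]; last by rewrite subn0.
  by rewrite !nth_nseq ltn_subLR// iL subn1.
have degb' : (w * L <= mdeg b')%N.
  rewrite mdegE (bigID (mem M))/= (leq_trans _ (leq_addr _ _))//.
  rewrite (eq_bigr (fun=> w)) ?sum_nat_const ?cM 1?mulnC//.
  by move=> k kM; rewrite b'M// bM.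
have wpos := chain_weight_gt0.
have Lw : (L.-1 <= mdeg b')%N.
  by apply: leq_trans degb'; rewrite (leq_trans (leq_pred _))// leq_pmull.
rewrite cM in Hb'.
have := regularity_ge (J := I n) (I_ideal n0) (monomial_idealP (I_ideal n0) (I_monomial n0))
  (fun i b Hb => (HCD n n0 i b Hb).1) (fun i b Hb => (HCD n n0 i b Hb).2) Hb'
  (esym (subnKC Lw)).
move=> le; apply: (@leq_trans (mdeg b' - L.-1 + w.-1 * e)); last by rewrite leq_add2r.
have nLe : n = (L + e)%N by rewrite /L subnK// ltnW.
rewrite {1}nLe mulnDr leq_add2r; move: degb'.
rewrite -(prednK wpos) mulSn; set x := (_ * L)%N; lia.
Qed.

End Chain.
(** * The limit *)
Section LinearGrowth.
Context {R : realType}.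


Lemma cvg_linear_growth (x : nat -> nat) (a C N : nat) :
  (forall n, (N <= n)%N -> (a * n <= x n + C)%N /\ (x n <= a * n + C)%N) ->
  ((x n)%:R / n%:R : R) @[n --> \oo] --> (a%:R : R).
Proof.
move=> H.
have C0 : (C%:R * (n%:R)^-1 : R) @[n --> \oo] --> (0 : R).
  rewrite -(mulr0 C%:R); apply: cvgMr.
  rewrite -(cvg_shiftS (fun n => n%:R^-1 : R)).
  exact: cvg_harmonic.
apply: (@squeeze_cvgr _ _ _ _ (fun n => a%:R - C%:R * n%:R^-1)
  (fun n => a%:R + C%:R * n%:R^-1)).
- near=> n.
  have n0 : (0 < n)%N by near: n; exists 1%N.
  have Nn : (N <= n)%N by near: n; exists N.
  have [lo hi] := H n Nn.
  have nR : (0 : R) < n%:R by rewrite ltr0n.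
  have nR0 : n%:R != 0 :> R by rewrite lt0r_neq0.
  apply/andP; split.
  + rewrite ler_pdivlMr//. rewrite mulrBl divfK// lerBlDr -natrM -natrD ler_nat//.
  + rewrite ler_pdivrMr// mulrDl divfK// -natrM -natrD ler_nat//.
- by rewrite -[X in _ --> X]subr0; apply: cvgB => //; exact: cvg_cst.
- by rewrite -[X in _ --> X]addr0; apply: cvgD => //; exact: cvg_cst.
Unshelve. all: by end_near.
Qed.

End LinearGrowth.

Unset Implicit Arguments.

Theorem theorem4p2 (K : fieldType) (R : realType)
    (I : forall n : nat, set {mpoly K[n]})
    (I_ideal : forall n, (1 <= n)%N -> is_ideal (I n))
    (I_monomial : forall n, (1 <= n)%N -> is_monomial_ideal (I n))
    (I_proper : forall n, (1 <= n)%N -> I n <> setT)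
    (I_invariant : Inc_invariant I)
    (I_nonzero : chain_nonzero I) :
  ((regularity (I n))%:R / n%:R : R) @[n --> \oo]
    --> ((chain_weight I)%:R - 1 : R).
Proof.
have [C1 up] := regularity_upper I_ideal I_monomial I_proper I_invariant I_nonzero.
have [C2 [N lo]] := regularity_lower I_ideal I_monomial I_proper I_invariant I_nonzero.
have w0 := chain_weight_gt0 I_ideal I_monomial I_proper I_invariant I_nonzero.
rewrite -[chain_weight I]prednK// -[in X in X - 1]addn1 natrD addrK.
apply: (@cvg_linear_growth R (fun n => regularity (I n)) _ (C1 + C2) N.+1) => n Nn.
split.
  by rewrite (leq_trans (lo n (ltnW Nn)))// leq_add2l leq_addl.
by rewrite (leq_trans (up n (leq_ltn_trans (leq0n _) Nn)))// leq_add2l leq_addr.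
Qed.
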